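(* Let $H$ be a graph and let $\mathcal{G}$ be the class of graphs that do not contain $H$ as an induced minor. Then the following statements are equivalent: 1. $\mathcal{G}$ is tame. 2. $\mathcal{G}$ is not feral. 3. $H$ is an induced subgraph of the diamond, the butterfly, or the house. 4. $H$ is an induced minor of the butterfly or of the house.
   Context: All graphs are finite, simple and undirected, and are considered up to isomorphism; ''is an induced subgraph of / induced minor of'' is up to isomorphism. A graph $H$ is an induced minor of a graph $G$ if $H$ can be obtained from $G$ by a sequence of vertex deletions and edge contractions (loops and parallel edges created by contraction are removed). A minimal separator in $G$ is a set $S\subseteq V(G)$ for which there exist nonadjacent vertices $a,b\in V(G)\setminus S$ belonging to distinct connected components of $G-S$, while for every proper subset $S'\subsetneq S$ the vertices $a$ and $b$ are in the same connected component of $G-S'$. A graph class $\mathcal{G}$ is tame if there is a polynomial $p$ such that every $G\in\mathcal{G}$ has at most $p(|V(G)|)$ minimal separators. It is feral if there is a constant $c>1$ such that infinitely many (pairwise nonisomorphic) graphs $G\in\mathcal{G}$ have at least $c^{|V(G)|}$ minimal separators. The diamond is $K_4$ minus an edge. The house is the graph with vertices $a,b,c,d,e$ and edges $ab,bc,cd,de,ae,ad$. The butterfly is the graph obtained from two disjoint edges (on four vertices) by adding a fifth vertex adjacent to all four of them. *)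

(* Defs.v *)
From HB Require Import structures.
From mathcomp Require Import all_boot all_order all_algebra.
From mathcomp Require Import reals.

Set Implicit Arguments.
Unset Strict Implicit.
Unset Printing Implicit Defensive.

Import Order.TTheory GRing.Theory Num.Theory.

(* The null graph (no vertices) is a graph. *)
Record sgraph := SGraph {
  svertex :> finType;
  sedge : rel svertex;
  sedge_sym : symmetric sedge;
  sedge_irrefl : irreflexive sedge }.

Definition isomorphic (G H : sgraph) : Prop :=
  exists2 f : G -> H,
    bijective f & forall x y : G, sedge (f x) (f y) = sedge x y.

Section Induced.
Variables (G : sgraph) (S : {set G}).

Definition induced_vertex : finType := {x : G | x \in S}.
Definition induced_edge : rel induced_vertex :=
  fun x y => sedge (val x) (val y).

Lemma induced_edge_sym : symmetric induced_edge.
Proof. by move=> x y; apply: sedge_sym. Qed.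

Lemma induced_edge_irrefl : irreflexive induced_edge.
Proof. by move=> x; apply: sedge_irrefl. Qed.

Definition induced : sgraph := SGraph induced_edge_sym induced_edge_irrefl.

End Induced.

Definition induced_subgraph (H G : sgraph) : Prop :=
  exists S : {set G}, isomorphic H (induced S).

Definition delete_vertex (G : sgraph) (v : G) : sgraph := induced [set~ v].

(* [contract u v] identifies v with u, the merged vertex keeping the name u.
   It is edge contraction when u and v are adjacent, which is required where
   it is used. *)
Section Contract.
Variables (G : sgraph) (u v : G).

Definition contract_vertex : finType := {x : G | x != v}.
Definition contract_edge : rel contract_vertex := fun x y =>
  (x != y) && [|| sedge (val x) (val y),
                  (val x == u) && sedge v (val y) |
                  (val y == u) && sedge v (val x)].

Lemma contract_edge_sym : symmetric contract_edge.
Proof.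
by move=> x y; rewrite /contract_edge eq_sym sedge_sym [X in _ || X]orbC.
Qed.

Lemma contract_edge_irrefl : irreflexive contract_edge.
Proof. by move=> x; rewrite /contract_edge eqxx. Qed.

Definition contract : sgraph := SGraph contract_edge_sym contract_edge_irrefl.

End Contract.

Inductive induced_minor (H : sgraph) : sgraph -> Prop :=
| IMiso (G : sgraph) of isomorphic H G : induced_minor H G
| IMdelete (G : sgraph) (v : G) of
    induced_minor H (delete_vertex v) : induced_minor H G
| IMcontract (G : sgraph) (u v : G) of sedge u v &
    induced_minor H (contract u v) : induced_minor H G.

Section MinimalSeparators.
Variable G : sgraph.

(* For x and y outside S: x and y lie in the same component of G - S. *)
Definition connected_avoiding (S : {set G}) (x y : G) : bool :=
  connect [rel z t | [&& z \notin S, t \notin S & sedge z t]] x y.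

Definition minimal_separator (S : {set G}) : bool :=
  [exists a, exists b,
    [&& a \notin S, b \notin S, ~~ sedge a b, ~~ connected_avoiding S a b &
        [forall S' : {set G}, (S' \proper S) ==> connected_avoiding S' a b]]].

Definition num_minimal_separators : nat := #|[set S | minimal_separator S]|.

End MinimalSeparators.

Definition graph_class := sgraph -> Prop.

Definition induced_minor_free (H : sgraph) : graph_class :=
  fun G => ~ induced_minor H G.

Section TameFeral.
Local Open Scope ring_scope.

Definition tame (R : realType) (C : graph_class) : Prop :=
  exists p : {poly R}, forall G : sgraph, C G ->
    (num_minimal_separators G)%:R <= p.[#|G|%:R].

Definition feral (R : realType) (C : graph_class) : Prop :=
  exists2 c : R, 1 < c &
  exists2 F : nat -> sgraph,
    forall i j : nat, i <> j -> ~ isomorphic (F i) (F j) &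
    forall i : nat,
      C (F i) /\ c ^+ #|F i| <= (num_minimal_separators (F i))%:R.

End TameFeral.

(* The graph on {0, ..., n-1} whose edges are the listed unordered pairs. *)
Section OfEdges.
Variables (n : nat) (E : seq (nat * nat)).

Definition list_edge : rel 'I_n := fun x y =>
  (x != y) && (((val x, val y) \in E) || ((val y, val x) \in E)).

Lemma list_edge_sym : symmetric list_edge.
Proof. by move=> x y; rewrite /list_edge eq_sym orbC. Qed.

Lemma list_edge_irrefl : irreflexive list_edge.
Proof. by move=> x; rewrite /list_edge eqxx. Qed.

Definition graph_of_edges : sgraph := SGraph list_edge_sym list_edge_irrefl.

End OfEdges.

(* The missing edge is {2, 3}. *)
Definition diamond : sgraph :=
  graph_of_edges 4 [:: (0, 1); (0, 2); (0, 3); (1, 2); (1, 3)].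

(* The vertices a, b, c, d, e are 0, 1, 2, 3, 4. *)
Definition house : sgraph :=
  graph_of_edges 5 [:: (0, 1); (1, 2); (2, 3); (3, 4); (0, 4); (0, 3)].

(* The disjoint edges are {0, 1} and {2, 3}; the fifth vertex is 4. *)
Definition butterfly : sgraph :=
  graph_of_edges 5 [:: (0, 1); (2, 3); (4, 0); (4, 1); (4, 2); (4, 3)].

(* Main.v *)
Require Import Defs.
From mathcomp Require Import all_boot all_order all_algebra.
From mathcomp Require Import reals ring.
From mathcomp Require boolp.

(** An induced minor of G is the same thing as a family of disjoint connected
    branch sets in G, two of which are joined by an edge exactly when the
    vertices they represent are adjacent ([induced_minor_model] and
    [model_induced_minor]).  All four conditions are compared through such
    models.

    A tame class is not feral, because an exponential outgrows a polynomial
    and only finitely many graphs have a given order.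

    Feral classes come from ladders: two hubs joined by k disjoint paths with
    two inner vertices each, where the inner vertices on the side of each hub
    are either independent or a clique.  One inner vertex from each path, chosen
    arbitrarily, gives a minimal separator, so there are at least 2^k of them
    on 2k+2 vertices.  If the class of H is not feral, H is therefore an
    induced minor of a ladder of each kind.  From the ladder with cliques H
    inherits a partition into two cliques, and from the other one that, apart
    from at most two hubs, H is a disjoint union of vertices and edges, attached
    to the hubs in a restricted way.  This leaves at most five vertices, and
    running through these graphs shows that each embeds in the diamond, the
    butterfly or the house.  The diamond is a contraction of the house.

    It remains to bound the number of minimal separators S of a graph without
    a house or without a butterfly.  Let A and B be two components of G - S
    with N(A) = N(B) = S ([minimal_separator_full]).  In both cases S is
    recovered from boundedly many vertices, so [card_small_sets] gives a
    polynomial bound.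

    Without a house, some X of at most two vertices of A dominates S
    ([house_free_dominated]), and then B is a component of G - N[X], so that X
    and one vertex of B determine S.

    Without a butterfly, every component of G - (A + B) has at most one
    neighbour in A or at most one in B ([hub_small]), and at most three
    vertices of A, and three of B, arise as such single neighbours
    ([terminals_bound]).  Let P and Q be these vertices, together with one
    arbitrary vertex of A and of B.  Deleting P and Q splits the graph into
    the part hanging on A and the part hanging on B, and S consists of the
    neighbours of P in the latter and of Q in the former.  To tell these parts
    apart it is enough to name vertices in the components that contain both a
    vertex adjacent to P but not to Q, or conversely, and a second attachment;
    two for each pair in P * Q suffice, since three such components form a
    butterfly ([three_components]). *)

Set Implicit Arguments.
Unset Strict Implicit.
Unset Printing Implicit Defensive.

Import Order.TTheory GRing.Theory Num.Theory.

Local Notation "x -- y" := (sedge x y) (at level 30).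

(** * Connected vertex sets and components *)

Section Connectivity.
Variable G : sgraph.
Implicit Types (X Y W : {set G}) (x y z u v : G).

Definition touch X Y : bool := [exists x in X, exists y in Y, x -- y].

(** Connectivity as an induction principle: whatever holds at one vertex of X
    and passes along the edges inside X holds on X.  In this form it transports
    through contractions and unions without handling paths. *)
Definition conn X : Prop :=
  X != set0 /\
  forall P : pred G, (exists2 x, x \in X & P x) ->
    (forall u v, u \in X -> v \in X -> P u -> u -- v -> P v) ->
    forall y, y \in X -> P y.

Lemma touchP X Y :
  reflect (exists x y, [/\ x \in X, y \in Y & x -- y]) (touch X Y).
Proof.
apply: (iffP existsP) => [[x /andP[xX /existsP[y /andP[yY xy]]]]|[x [y [xX yY xy]]]].
  by exists x, y.
by exists x; rewrite xX; apply/existsP; exists y; rewrite yY.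
Qed.

Lemma touchPn X Y :
  reflect (forall x y, x \in X -> y \in Y -> x -- y = false) (~~ touch X Y).
Proof.
apply: (iffP negP) => [nt x y xX yY|nt /touchP[x [y [xX yY]]]]; last by rewrite nt.
by apply/negP => xy; apply: nt; apply/touchP; exists x, y.
Qed.

Lemma touch_sym X Y : touch X Y = touch Y X.
Proof.
by apply/touchP/touchP => -[x [y [xX yY xy]]]; exists y, x; rewrite sedge_sym.
Qed.

Lemma touch11 x y : touch [set x] [set y] = x -- y.
Proof.
apply/touchP/idP => [[_ [_ [/set1P-> /set1P->]]] //|xy].
by exists x, y; rewrite !set11.
Qed.

Lemma touchUl X Y Z : touch (X :|: Y) Z = touch X Z || touch Y Z.
Proof.
apply/touchP/orP => [[x [z [/setUP[xX|xY] zZ xz]]]|].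
- by left; apply/touchP; exists x, z.
- by right; apply/touchP; exists x, z.
by case=> /touchP[x [z [xX zZ xz]]]; exists x, z; rewrite inE xX ?orbT.
Qed.

Lemma touchUr X Y Z : touch Z (X :|: Y) = touch Z X || touch Z Y.
Proof. by rewrite !(touch_sym Z) touchUl. Qed.

Lemma conn_neq0 X : conn X -> exists x, x \in X.
Proof. by case=> /set0Pn. Qed.

Lemma conn1 x : conn [set x].
Proof.
split=> [|P [_ /set1P-> Px] _ y /set1P-> //].
by apply/set0Pn; exists x; rewrite set11.
Qed.

Lemma connU X Y : conn X -> conn Y -> touch X Y -> conn (X :|: Y).
Proof.
move=> cX cY /touchP[x [y [xX yY xy]]]; split.
  by apply/set0Pn; exists x; rewrite inE xX.
move=> P [z zXY Pz] Pcl.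
have clX u v : u \in X -> v \in X -> P u -> u -- v -> P v.
  by move=> uX vX; apply: Pcl; rewrite inE ?uX ?vX.
have clY u v : u \in Y -> v \in Y -> P u -> u -- v -> P v.
  by move=> uX vX; apply: Pcl; rewrite inE ?uX ?vX orbT.
have allX w : w \in X -> P w -> forall u, u \in X -> P u.
  by move=> wX Pw; apply: cX.2 => //; exists w.
have allY w : w \in Y -> P w -> forall u, u \in Y -> P u.
  by move=> wX Pw; apply: cY.2 => //; exists w.
have Pxy : P x && P y.
  case/setUP: zXY => [zX|zY].
    have Px := allX _ zX Pz _ xX.
    by rewrite Px; apply: Pcl xy => //; rewrite inE ?xX ?yY ?orbT.
  have Py := allY _ zY Pz _ yY.
  by rewrite Py andbT; apply: (Pcl y x) => //; rewrite ?inE ?xX ?yY ?orbT // sedge_sym.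
case/andP: Pxy => Px Py u /setUP[]; [exact: (allX x)|exact: (allY y)].
Qed.

(** The usual way to use connectivity: an edge leaves every proper part. *)
Lemma conn_exit X (P : pred G) x y :
  conn X -> x \in X -> P x -> y \in X -> ~~ P y ->
  exists u v, [/\ u \in X, v \in X, P u, ~~ P v & u -- v].
Proof.
move=> cX xX Px yX nPy.
case: (boolP [exists u in X, exists v in X, [&& P u, ~~ P v & u -- v]]).
  case/existsP=> u /andP[uX /existsP[v /andP[vX /and3P[Pu nPv uv]]]].
  by exists u, v.
move=> nex; case/negP: nPy; apply: cX.2 yX; first by exists x.
move=> u v uX vX Pu uv; apply: contraNT nex => nPv.
by apply/existsP; exists u; rewrite uX; apply/existsP; exists v; rewrite vX Pu nPv.
Qed.

(** Both ends of each edge have to lie in W, so a vertex outside W forms a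
    component by itself. *)
Definition component W x : {set G} :=
  [set y | connect [rel u v | [&& u \in W, v \in W & u -- v]] x y].

Lemma component_refl W x : x \in component W x.
Proof. by rewrite inE connect0. Qed.

Lemma component_closed W x u v :
  u \in component W x -> u \in W -> v \in W -> u -- v -> v \in component W x.
Proof.
rewrite !inE => xu uW vW uv; apply: connect_trans xu (connect1 _).
by rewrite /= uW vW.
Qed.

Lemma component_ind W (P : pred G) x y :
  y \in component W x -> P x ->
  (forall u v, u \in W -> v \in W -> P u -> u -- v -> P v) -> P y.
Proof.
rewrite inE => /connectP[p pth ->] Px cl.
elim: p x Px pth => //= z p IH x Px /andP[/and3P[xW zW xz] pth].
by apply: (IH z) => //; apply: cl xz.
Qed.

Lemma component_sub W x : x \in W -> component W x \subset W.
Proof.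
by move=> xW; apply/subsetP=> y yC; exact: (component_ind (P := fun z => z \in W) yC xW).
Qed.

Lemma component_sym W x y : (y \in component W x) = (x \in component W y).
Proof.
rewrite !inE; apply: sym_connect_sym => u v /=.
by rewrite sedge_sym andbCA.
Qed.

Lemma component_trans W x y z : y \in component W x -> z \in component W y -> z \in component W x.
Proof. by rewrite !inE; apply: connect_trans. Qed.

Lemma component_eq W x y : y \in component W x -> component W y = component W x.
Proof.
move=> yx; apply/setP=> z; apply/idP/idP; first exact: component_trans.
by apply: component_trans; rewrite component_sym.
Qed.

Lemma component_conn W x : x \in W -> conn (component W x).
Proof.
move=> xW; have sub := subsetP (component_sub xW); split.
  by apply/set0Pn; exists x; apply: component_refl.
move=> P [z zC Pz] cl y yC.
have zW := sub _ zC; rewrite -(component_eq zC) in yC.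
pose Q := [pred w | (w \in component W x) && P w].
suff /andP[] : Q y by [].
apply: (component_ind (P := Q) yC); first by rewrite /= zC.
move=> u v uW vW /andP[uC Pu] uv; have vC := component_closed uC uW vW uv.
by rewrite /= vC; apply: cl uv.
Qed.

Lemma conn_sub_component W X x : conn X -> X \subset W -> x \in X -> X \subset component W x.
Proof.
move=> cX /subsetP sXW xX; apply/subsetP; apply: cX.2.
  by exists x => //; apply: component_refl.
by move=> u v uX vX uC uv; apply: component_closed uv => //; apply: sXW.
Qed.

(** Take for X1 the component of x in X minus y.  The other components of X
    minus y all touch y, so the rest of X stays connected around y. *)
Lemma conn_split X x y : conn X -> x \in X -> y \in X -> x != y ->
  exists X1 X2, [/\ conn X1, conn X2, x \in X1, y \in X2 & 
     [/\ X1 :|: X2 = X, [disjoint X1 & X2] & touch X1 X2]].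
Proof.
move=> cX xX yX xy.
have xXy : x \in X :\ y by rewrite !inE xy.
pose X1 := component (X :\ y) x.
have sX1 : X1 \subset X :\ y by apply: component_sub.
have sX1X : X1 \subset X by apply: subset_trans sX1 (subsetDl _ _).
have yX1 : y \notin X1 by apply/negP=> /(subsetP sX1); rewrite !inE eqxx.
have xX1 : x \in X1 by apply: component_refl.
have yX2 : y \in X :\: X1 by rewrite inE yX1.
exists X1, (X :\: X1); split=> //; first exact: component_conn.
- split; first by apply/set0Pn; exists y.
  have yall (P : pred G) : P y ->
    (forall u v, u \in X :\: X1 -> v \in X :\: X1 -> P u -> u -- v -> P v) ->
    forall z, z \in X :\: X1 -> P z.
  { move=> Py cl z; rewrite inE => /andP[zX1 zX].
    pose Q := [pred w | (w \in X1) || P w].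
    suff : Q z by rewrite /= (negPf zX1).
    move: z zX {zX1}; apply: cX.2; first by exists y; rewrite //= Py orbT.
    move=> u v uX vX /= Qu uv.
    rewrite /=; case: (boolP (v \in X1)) => //= vX1.
    have [->|vy] := eqVneq v y; first by [].
    have uX1 : u \notin X1.
      apply: contra vX1 => uX1; apply: (component_closed uX1) uv; last by rewrite !inE vy.
      exact: (subsetP sX1).
    have Pu : P u by case/orP: Qu => //; rewrite (negPf uX1).
    by apply: (cl u v) => //; rewrite inE ?uX1 ?vX1. }
  move=> P [z zX2 Pz] cl w wX2.
  case: (boolP (P y)) => Py; first exact: yall.
  have /negP[] : ~~ P z.
    apply: (yall [pred u | ~~ P u]) zX2 => //= u v uX vX nPu uv.
    apply: contra nPu => Pv; apply: cl Pv _ => //.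
    by rewrite sedge_sym.
  done.
split.
- apply/setP=> z; rewrite in_setU in_setD.
  by case: (boolP (z \in X1)) => [/(subsetP sX1X)->|].
- by rewrite -setI_eq0; apply/eqP/setP=> z; rewrite in_setI in_setD in_set0; case: (z \in X1).
have [u [v [uX vX uX1 vX1 uv]]] := conn_exit cX xX xX1 yX yX1.
by apply/touchP; exists u, v; rewrite in_setD; split=> //; apply/andP.
Qed.

End Connectivity.

(** * Models of induced minors *)

Definition model (H G : sgraph) (phi : H -> {set G}) : Prop :=
  [/\ forall x, conn (phi x),
      forall x y, x != y -> [disjoint phi x & phi y] &
      forall x y, x != y -> x -- y = touch (phi x) (phi y)].

Lemma disjoint_contra (T : finType) (X Y : {set T}) (z : T) :
  [disjoint X & Y] -> z \in X -> z \in Y -> False.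
Proof. by move=> /pred0P/(_ z) /= h zX zY; rewrite zX zY in h. Qed.

Lemma disjoint_intro (T : finType) (X Y : {set T}) :
  (forall z, z \in X -> z \in Y -> False) -> [disjoint X & Y].
Proof. by move=> h; apply/pred0P=> z /=; apply/negP=> /andP[]; apply: h. Qed.

(** A property of one vertex spreads over its inner branch set by the
    connectivity of that set, and then from one inner branch set to the next
    along the edges of G inside the outer branch set. *)
Lemma model_comp (H G K : sgraph) (phi : H -> {set G}) (psi : G -> {set K}) :
  model phi -> model psi -> model (fun x => \bigcup_(y in phi x) psi y).
Proof.
move=> [cphi dphi ephi] [cpsi dpsi epsi]; split.
- move=> x; split.
    have [y yx] := conn_neq0 (cphi x); have [z zy] := conn_neq0 (cpsi y).
    by apply/set0Pn; exists z; apply/bigcupP; exists y.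
  move=> P [z0 /bigcupP[y0 y0x z0y] Pz0] cl.
  have spread y : y \in phi x -> (exists2 z, z \in psi y & P z) ->
      forall z, z \in psi y -> P z.
    move=> yx exz; apply: (cpsi y).2 exz _ => u v uy vy Pu uv.
    by apply: (cl u v) => //; apply/bigcupP; exists y.
  pose Q := [pred y | [forall z in psi y, P z]].
  suff allQ y : y \in phi x -> Q y.
    by move=> z /bigcupP[y yx zy]; move/forall_inP: (allQ _ yx); apply.
  apply: (cphi x).2.
    by exists y0 => //; apply/forall_inP; apply: spread => //; exists z0.
  move=> u v ux vx /forall_inP Qu uv; apply/forall_inP; apply: spread => //.
  have neq : u != v by apply: contraTneq uv => ->; rewrite sedge_irrefl.
  move: uv; rewrite epsi // => /touchP[a [b [au bv ab]]]; exists b => //.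
  by apply: (cl a b) (Qu _ au) ab; apply/bigcupP; [exists u|exists v].
- move=> x y xy; apply: disjoint_intro => z /bigcupP[a ax za] /bigcupP[b bY zb].
  have [ab|ab] := eqVneq a b; first by apply: (disjoint_contra (dphi _ _ xy) ax); rewrite ab.
  exact: (disjoint_contra (dpsi _ _ ab) za zb).
move=> x y xy; rewrite ephi //; apply/touchP/touchP.
  move=> [u [v [ux vy uv]]].
  have neq : u != v by apply: contraTneq uv => ->; rewrite sedge_irrefl.
  move: uv; rewrite epsi // => /touchP[a [b [au bv ab]]]; exists a, b.
  by split=> //; apply/bigcupP; [exists u|exists v].
move=> [a [b [/bigcupP[u ux au] /bigcupP[v vy bv] ab]]]; exists u, v; split=> //.
have neq : u != v.
  by apply/eqP=> uv; apply: (disjoint_contra (dphi _ _ xy) ux); rewrite uv.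
by rewrite epsi //; apply/touchP; exists a, b.
Qed.

Lemma model_embedding (H G : sgraph) (f : H -> G) :
  injective f -> (forall x y, f x -- f y = x -- y) ->
  model (fun x => [set f x]).
Proof.
move=> finj fe; split=> [x|x y xy|x y xy]; first exact: conn1.
  by rewrite disjoints1 inE (inj_eq finj).
by rewrite touch11 fe.
Qed.

Lemma embedding_induced_subgraph (H G : sgraph) (f : H -> G) :
  injective f -> (forall x y, f x -- f y = x -- y) -> induced_subgraph H G.
Proof.
move=> finj fe; exists [set f x | x in H].
pose g (x : H) : induced [set f x | x in H] :=
  exist _ (f x) (imset_f f (erefl : x \in [pred _ : H | true])).
exists g; last by move=> x y; apply: fe.
apply: inj_card_bij; first by move=> x y /(congr1 val) /finj.
by rewrite card_sig (eq_card (B := mem [set f x | x in H])) // card_imset.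
Qed.

Lemma induced_subgraph_embedding (H G : sgraph) : induced_subgraph H G ->
  exists2 f : H -> G, injective f & forall x y, f x -- f y = x -- y.
Proof.
move=> [S [f /bij_inj finj fe]]; exists (fun x => val (f x)).
  by move=> x y /val_inj /finj.
exact: fe.
Qed.

Lemma model_delete (G : sgraph) (v : G) :
  model (fun x : delete_vertex v => [set val x]).
Proof. by apply: model_embedding => //; apply: val_inj. Qed.

Section ContractModel.
Variables (G : sgraph) (u v : G).
Hypothesis uv : u -- v.

(** The vertex of G that survives the contraction stands for both ends. *)
Definition contract_bag (x : contract u v) : {set G} :=
  val x |: (if val x == u then [set v] else set0).

Let neq_uv : u != v.
Proof. by apply: contraTneq uv => ->; rewrite sedge_irrefl. Qed.

Lemma contract_bagE (x : contract u v) z :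
  (z \in contract_bag x) = (val x == (if z == v then u else z)).
Proof.
rewrite !inE (eq_sym z); have := valP x; rewrite /=.
have [->|zv] := eqVneq z v.
  by move=> xv; rewrite (negPf xv) /=; case: ifP; rewrite !inE ?eqxx.
by move=> xv; case: ifP; rewrite !inE ?(negPf zv) orbF.
Qed.

Lemma model_contract : model contract_bag.
Proof.
split=> [x|x y xy|x y xy].
- rewrite /contract_bag; case: eqP => [->|_]; last by rewrite setU0; apply: conn1.
  by apply: connU; [exact: conn1|exact: conn1|rewrite touch11].
- apply: disjoint_intro=> z; rewrite !contract_bagE => /eqP zx /eqP zy.
  by move/eqP: xy; apply; apply: val_inj; rewrite zx zy.
rewrite [LHS]/= /contract_edge xy /= /contract_bag.
have [xv yv] := (valP x, valP y); rewrite /= in xv yv.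
rewrite touchUl !touchUr touch11.
have t0 X : touch X set0 = false.
  by apply/negbTE/touchPn=> a b _; rewrite inE.
have t0' X : touch set0 X = false by rewrite touch_sym t0.
case: (eqVneq (val x) u) => xu; case: (eqVneq (val y) u) => yu; rewrite ?t0 ?t0' ?touch11 ?orbF //=.
- by case/eqP: xy; apply: val_inj; rewrite xu yu.
- by rewrite (sedge_sym v).
Qed.

End ContractModel.

(** Deletion and contraction of one edge have obvious models; compose them. *)
Lemma induced_minor_model (H G : sgraph) :
  induced_minor H G -> exists phi : H -> {set G}, model phi.
Proof.
elim=> {G} [G [f /bij_inj finj fe]|G v _ [phi mphi]|G u v uv _ [phi mphi]].
- by exists (fun x => [set f x]); apply: model_embedding.
- by eexists; apply: (model_comp mphi (model_delete v)).
by eexists; apply: (model_comp mphi (model_contract uv)).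
Qed.

(** Induction on the order of G.  A vertex in no branch set is deleted; if all
    are covered, an edge inside a branch set with two vertices is contracted;
    if there is no such branch set either, the model is an isomorphism. *)
Lemma model_induced_minor (H G : sgraph) (phi : H -> {set G}) :
  model phi -> induced_minor H G.
Proof.
have [n] := ubnP #|G|; elim: n => // n IH in G phi *; rewrite ltnS => leGn.
move=> [cphi dphi ephi].
have [cov|] := boolP [forall v : G, exists x, v \in phi x]; last first.
  move=> /forallPn[v /existsPn nv]; apply: (@IMdelete _ _ v).
  have card_del : #|delete_vertex v| = #|G|.-1.
    by rewrite card_sig (eq_card (B := mem [set~ v])) // cardsC1.
  have G0 : 0 < #|G| by apply/card_gt0P; exists v.
  apply: (IH (delete_vertex v) (fun x => [set y : delete_vertex v | val y \in phi x])).
    by rewrite card_del prednK.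
  have lift x z : z \in phi x -> {y : delete_vertex v | val y = z}.
    move=> zx; have zv : z \in [set~ v].
      by rewrite !inE; apply: contraTneq zx => ->; apply: nv.
    by exists (exist _ z zv).
  split=> [x|x y xy|x y xy].
  - split.
      have [z zx] := conn_neq0 (cphi x); have [y yz] := lift _ _ zx.
      by apply/set0Pn; exists y; rewrite inE yz.
    move=> P [y0 y0x Py0] cl.
    pose Q := [pred z : G | [forall y : delete_vertex v, (val y == z) ==> P y]].
    suff allQ z : z \in phi x -> Q z.
      move=> y; rewrite inE => /allQ /forallP/(_ y); by rewrite eqxx.
    apply: (cphi x).2.
      exists (val y0); first by rewrite inE in y0x.
      by apply/forallP=> y; apply/implyP=> /eqP/val_inj->.
    move=> a b ax bx /forallP Qa ab; apply/forallP=> y; apply/implyP=> /eqP yb.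
    have [c ca] := lift _ _ ax; have := Qa c; rewrite ca eqxx /= => Pc.
    by apply: (cl c y) => //; rewrite ?inE ?ca ?yb //= /induced_edge ca yb.
  - apply: disjoint_intro => z; rewrite !inE; exact: disjoint_contra (dphi _ _ xy).
  rewrite ephi //; apply/touchP/touchP=> [[a [b [ax bY ab]]]|[a [b []]]].
    have [c ca] := lift _ _ ax; have [d db] := lift _ _ bY.
    by exists c, d; rewrite !inE ca db; split=> //; rewrite /= /induced_edge ca db.
  by rewrite !inE => ax bY ab; exists (val a), (val b).
have {}cov : forall v, exists x, v \in phi x by move=> v; apply/existsP/(forallP cov).
have [sing|] := boolP [forall x, #|phi x| == 1].
  apply: IMiso; have getf x : exists v, phi x = [set v] by apply/cards1P/(forallP sing).
  have [f fE] := fin_all_exists getf.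
  have finj : injective f.
    move=> x y fxy; have [//|xy] := eqVneq x y.
    by have := dphi _ _ xy; rewrite !fE fxy disjoints1 inE eqxx.
  exists f; last first.
    move=> x y; have [->|xy] := eqVneq x y; first by rewrite !sedge_irrefl.
    by rewrite [RHS]ephi // !fE touch11.
  apply: inj_card_bij => //; rewrite -(card_codom finj); apply: subset_leq_card.
  apply/subsetP=> v _; have [x] := cov v; rewrite fE => /set1P->.
  exact: codom_f.
move=> /forallPn[x0 x01].
have [u ux0] := conn_neq0 (cphi x0).
have [v vx0 uv] : exists2 v, v \in phi x0 & u -- v.
  have [w wx0 wu] : exists2 w, w \in phi x0 & w != u.
    have : 0 < #|phi x0 :\ u|.
      by move: x01; rewrite (cardsD1 u) ux0; case: #|_|.
    by case/card_gt0P=> w; rewrite !inE => /andP[? ?]; exists w.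
  have [a [b [ax bx /eqP-> _ ab]]] := conn_exit (P := pred1 u) (cphi x0) ux0 (eqxx u) wx0 wu.
  by exists b.
have neq_uv : u != v by apply: contraTneq uv => ->; rewrite sedge_irrefl.
apply: (@IMcontract _ _ u v uv).
have bagE x : v \in phi x -> u \in phi x.
  have [->//|xx0 vx] := eqVneq x x0.
  by case: (disjoint_contra (dphi _ _ xx0) vx vx0).
have bagE' x : u \in phi x -> v \in phi x.
  have [->//|xx0 vx] := eqVneq x x0.
  by case: (disjoint_contra (dphi _ _ xx0) vx ux0).
have card_con : #|contract u v| = #|G|.-1.
  rewrite card_sig -(cardsC1 v); apply: eq_card => z.
  by rewrite !inE.
have G0 : 0 < #|G| by apply/card_gt0P; exists v.
(* The contraction map; it sends v to u. *)
pose f (z : G) : contract u v := insubd (exist _ u neq_uv) z.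
have valf z : val (f z) = if z == v then u else z.
  by rewrite val_insubd; case: eqVneq.
have fphi z x : (val (f z) \in phi x) = (z \in phi x).
  rewrite valf; case: eqVneq => // ->; apply/idP/idP; [exact: bagE'|exact: bagE].
have fval y : f (val y) = y by apply: val_inj; rewrite valf (negPf (valP y)).
have fedge a b : a -- b -> f a != f b -> f a -- f b.
  move=> ab nab; change (contract_edge u (f a) (f b)); rewrite /contract_edge nab !valf.
  have [av|av] := eqVneq a v; have [bv|bv] := eqVneq b v => /=.
  - by rewrite av bv sedge_irrefl in ab.
  - have vb : v -- b by rewrite -av.
    by rewrite eqxx vb !orbT.
  - have va : v -- a by rewrite -bv sedge_sym.
    by rewrite eqxx va !orbT.
  - by rewrite ab.
have edgef (a b : contract u v) : a -- b -> exists c d, [/\ f c = a, f d = b & c -- d].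
  case/andP=> nab /or3P[].
  - by move=> ab; exists (val a), (val b).
  - case/andP=> /eqP au vb; exists v, (val b); split=> //.
    by apply: val_inj; rewrite valf eqxx.
  - case/andP=> /eqP bu va; exists (val a), v; split=> //; last by rewrite sedge_sym.
    by apply: val_inj; rewrite valf eqxx.
apply: (IH (contract u v) (fun x => [set y : contract u v | val y \in phi x])); first by rewrite card_con prednK.
split=> [x|x y xy|x y xy].
- split.
    have [z zx] := conn_neq0 (cphi x).
    by apply/set0Pn; exists (f z); rewrite inE fphi.
  move=> P [y0 y0x Py0] cl.
  suff allQ z : z \in phi x -> P (f z).
    by move=> y; rewrite inE => /allQ; rewrite fval.
  apply: ((cphi x).2 [pred z | P (f z)]).
    by exists (val y0); [rewrite inE in y0x|rewrite /= fval].
  move=> a b ax bx /= Pa ab.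
  have [<-//|nab] := eqVneq (f a) (f b).
  by apply: (cl (f a) (f b)) => //; rewrite ?inE ?fphi //; apply: fedge.
- apply: disjoint_intro => z; rewrite !inE; exact: disjoint_contra (dphi _ _ xy).
rewrite ephi //; apply/touchP/touchP=> [[a [b [ax bY ab]]]|[a [b []]]].
  exists (f a), (f b); rewrite !inE !fphi; split=> //; apply: fedge => //.
  apply/eqP=> fab; apply: (disjoint_contra (dphi _ _ xy) ax).
  by rewrite -fphi fab fphi.
rewrite !inE => ax bY /edgef[c [d [ca db cd]]]; exists c, d.
by rewrite -!(fphi c) -!(fphi d) ca db.
Qed.

Lemma induced_minor_trans (H G K : sgraph) :
  induced_minor H G -> induced_minor G K -> induced_minor H K.
Proof.
move=> /induced_minor_model[phi mphi] /induced_minor_model[psi mpsi].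
exact: model_induced_minor (model_comp mphi mpsi).
Qed.

Lemma induced_subgraph_minor (H G : sgraph) :
  induced_subgraph H G -> induced_minor H G.
Proof.
move=> /induced_subgraph_embedding[f finj fe].
exact: model_induced_minor (model_embedding finj fe).
Qed.

(** * Full components of a minimal separator *)

Section FullComponents.
Variable G : sgraph.
Implicit Types (S X Y A B W : {set G}) (s u v w x y : G).

Definition nbh X : {set G} := [set v | (v \notin X) && touch [set v] X].

Lemma nbhP X v : reflect (v \notin X /\ exists2 x, x \in X & v -- x) (v \in nbh X).
Proof.
rewrite inE; apply: (iffP andP) => -[vX h]; split=> //.
  by case/touchP: h => _ [x [/set1P-> xX vx]]; exists x.
by case: h => x xX vx; apply/touchP; exists v, x; rewrite set11.
Qed.

Record full_pair S A B : Prop := FullPair {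
  fp_connl : conn A;
  fp_connr : conn B;
  fp_disj : [disjoint A & B];
  fp_anti : ~~ touch A B;
  fp_nbhl : nbh A = S;
  fp_nbhr : nbh B = S }.

Lemma full_pair_sym S A B : full_pair S A B -> full_pair S B A.
Proof. by case=> *; split=> //; rewrite 1?disjoint_sym 1?touch_sym. Qed.

Lemma connected_avoidingE S x y :
  connected_avoiding S x y = (y \in component (~: S) x).
Proof. by rewrite inE; apply: eq_connect => u v /=; rewrite !inE. Qed.

(** If some s in S had no neighbour in the component of a, that component would
    remain closed when s is put back, and S minus s would still separate. *)
Lemma full_comp S a b :
  a \notin S -> ~~ connected_avoiding S a b ->
  (forall S' : {set G}, S' \proper S -> connected_avoiding S' a b) ->
  nbh (component (~: S) a) = S.
Proof.
move=> aS nab sep.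
have aS' : a \in ~: S by rewrite inE.
have subA := subsetP (component_sub aS').
have nbA : b \notin component (~: S) a.
  by rewrite -connected_avoidingE.
apply/setP=> s; apply/nbhP/idP=> [[sA [x xA sx]]|sS].
  case: (boolP (s \in S)) => // nsS; case/negP: sA.
  by apply: (component_closed xA); [exact: subA|rewrite in_setC|rewrite sedge_sym].
have sA : s \notin component (~: S) a.
  by apply/negP=> /subA; rewrite inE sS.
split=> //.
have [x /andP[xA sx]|none] := pickP [pred x in component (~: S) a | s -- x]; first by exists x.
case/negP: nbA.
have := sep (S :\ s) (properD1 sS); rewrite connected_avoidingE => bS.
apply: (component_ind (P := fun z => z \in component (~: S) a) bS).
  exact: component_refl.
move=> x z _; rewrite in_setC in_setD1 => zS xA xz.
have zs : z != s.
  by apply/eqP=> zs; have /= := none x; rewrite xA -zs sedge_sym xz.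
by apply: (component_closed xA) xz; [exact: subA|rewrite in_setC; move: zS; rewrite zs].
Qed.

Lemma minimal_separator_full S :
  minimal_separator S -> exists A B, full_pair S A B.
Proof.
case/existsP=> a /existsP[b /and5P[aS bS ab nab /forallP sep]].
have {}sep S' : S' \proper S -> connected_avoiding S' a b by apply/implyP/sep.
have symc (S' : {set G}) x y : connected_avoiding S' x y = connected_avoiding S' y x.
  by apply: sym_connect_sym => u v /=; rewrite sedge_sym andbCA.
have NA := full_comp aS nab sep.
have NB : nbh (component (~: S) b) = S.
  by apply: (@full_comp S b a) => // [|S' /sep]; rewrite symc.
have [aS' bS'] : a \in ~: S /\ b \in ~: S by rewrite !inE.
have dis : [disjoint component (~: S) a & component (~: S) b].
  apply: disjoint_intro => z za zb; case/negP: nab.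
  by rewrite connected_avoidingE -(component_eq za) component_sym.
exists (component (~: S) a), (component (~: S) b); split=> //; try exact: component_conn.
apply/touchPn=> x y xa yb; apply/negP=> xy.
have xb : x \in component (~: S) b.
  apply: (component_closed yb); last by rewrite sedge_sym.
    exact: (subsetP (component_sub bS')).
  exact: (subsetP (component_sub aS')).
exact: (disjoint_contra dis xa xb).
Qed.

Section FullPairFacts.
Variables S A B : {set G}.
Hypothesis fp : full_pair S A B.

Lemma fp_adjl s : s \in S -> exists2 x, x \in A & s -- x.
Proof. by rewrite -(fp_nbhl fp) => /nbhP[]. Qed.

Lemma fp_adjr s : s \in S -> exists2 x, x \in B & s -- x.
Proof. by rewrite -(fp_nbhr fp) => /nbhP[]. Qed.

Lemma fp_notl s : s \in S -> s \notin A.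
Proof. by rewrite -(fp_nbhl fp) => /nbhP[]. Qed.

Lemma fp_notr s : s \in S -> s \notin B.
Proof. by rewrite -(fp_nbhr fp) => /nbhP[]. Qed.

Lemma fp_inl s x : s \notin A -> x \in A -> s -- x -> s \in S.
Proof. by move=> sA xA sx; rewrite -(fp_nbhl fp); apply/nbhP; split=> //; exists x. Qed.

Lemma fp_inr s x : s \notin B -> x \in B -> s -- x -> s \in S.
Proof. by move=> sA xA sx; rewrite -(fp_nbhr fp); apply/nbhP; split=> //; exists x. Qed.

Lemma fp_edge x y : x \in A -> y \in B -> x -- y = false.
Proof. by move/touchPn: (fp_anti fp); apply. Qed.

(** Removing N[X] with X inside A takes away S and leaves B intact, so B
    reappears as a component.  Thus a small set X dominating S from inside A
    determines S, given one vertex of B. *)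
Lemma fp_comp X b : X \subset A -> S \subset nbh X -> b \in B ->
  component (~: (X :|: nbh X)) b = B.
Proof.
move=> /subsetP sXA /subsetP sSX bB.
have BW x : x \in B -> x \in ~: (X :|: nbh X).
  move=> xB; rewrite in_setC in_setU negb_or; apply/andP; split.
    by apply/negP=> /sXA xA; apply: (disjoint_contra (fp_disj fp) xA xB).
  apply/nbhP=> -[xX [y /sXA yA xy]].
  by move: (fp_edge yA xB); rewrite sedge_sym xy.
apply/eqP; rewrite eqEsubset; apply/andP; split; last first.
  apply: conn_sub_component => //; [exact: fp_connr fp|by apply/subsetP].
apply/subsetP=> y yC.
apply: (component_ind (P := fun z => z \in B) yC) => // u v uW vW uB uv.
case: (boolP (v \in B)) => // vB; move: vW; rewrite in_setC in_setU negb_or.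
by case/andP=> _ /negP[]; apply: sSX; apply: (fp_inr vB uB); rewrite sedge_sym.
Qed.

End FullPairFacts.
End FullComponents.

(** * Counting by bounded codes, and small models *)

(** A set of at most K elements is the set of values of a K-tuple over T with
    blanks; hence the base #|T|.+1. *)
Lemma card_small_sets (T : finType) (K : nat) (F : {set {set T}})
    (f : {set T} -> {set T} -> {set T} -> {set T} -> {set T}) :
  (forall S, S \in F -> exists P Q X Y : {set T},
     [/\ #|P| <= K, #|Q| <= K, #|X| <= K, #|Y| <= K & S = f P Q X Y]) ->
  #|F| <= #|T|.+1 ^ (4 * K).
Proof.
move=> hF; pose code : finType := {ffun 'I_K -> option T}.
pose dec (t : code) : {set T} := [set x | [exists i, t i == Some x]].
have decP (P : {set T}) : #|P| <= K -> exists t, P = dec t.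
  move=> PK; exists [ffun i : 'I_K => nth None (map Some (enum P)) i].
  apply/setP=> x; rewrite inE; apply/idP/existsP=> [xP|[i]].
    have ltP : index x (enum P) < size (enum P) by rewrite index_mem mem_enum.
    have ltK : index x (enum P) < K by apply: leq_trans ltP _; rewrite -cardE.
    exists (Ordinal ltK); rewrite ffunE /= (nth_map x) ?nth_index //.
    by rewrite mem_enum.
  rewrite ffunE; have [iP|iP] := ltnP i (size (enum P)).
    by rewrite (nth_map x) // => /eqP[<-]; rewrite -mem_enum mem_nth.
  by rewrite nth_default // size_map.
pose g (t : (code * code) * (code * code)) :=
  f (dec t.1.1) (dec t.1.2) (dec t.2.1) (dec t.2.2).
apply: (@leq_trans #|[set g t | t in {: (code * code) * (code * code)}]|).
  apply/subset_leq_card/subsetP=> S /hF[P [Q [X [Y]]]].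
  case=> /decP[p ->] /decP[q ->] /decP[x ->] /decP[y ->] ->.
  by apply/imsetP; exists ((p, q), (x, y)).
apply: leq_trans (leq_imset_card _ _) _.
by rewrite !card_prod card_ffun card_option card_ord -!expnD !mulSn mul0n addn0 !addnA.
Qed.

(** By symmetry it is enough to check the pairs i < j. *)
Lemma list_model (n : nat) (E : seq (nat * nat)) (G : sgraph) (X : nat -> {set G}) :
  (forall i, i < n -> conn (X i)) ->
  (forall i j, i < j -> j < n -> [disjoint X i & X j]) ->
  (forall i j, i < j -> j < n ->
     ((i, j) \in E) || ((j, i) \in E) = touch (X i) (X j)) ->
  induced_minor (graph_of_edges n E) G.
Proof.
move=> cX dX eX; apply: (@model_induced_minor _ _ (fun i : graph_of_edges n E => X (i : 'I_n))).
split=> [i|i j|i j]; first exact: cX.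
  rewrite neq_ltn => /orP[] lt; first exact: dX.
  by rewrite disjoint_sym; apply: dX.
move=> ij; rewrite /= /list_edge ij /=; move: ij.
rewrite neq_ltn => /orP[] lt; first exact: eX.
by rewrite orbC touch_sym; apply: eX.
Qed.

Lemma house_minor (G : sgraph) (a b c d e : {set G}) :
  (forall X, X \in [:: a; b; c; d; e] -> conn X) ->
  pairwise (fun X Y : {set G} => [disjoint X & Y]) [:: a; b; c; d; e] ->
  [&& touch a b, touch b c, touch c d, touch d e, touch a e & touch a d] ->
  [&& ~~ touch a c, ~~ touch b d, ~~ touch b e & ~~ touch c e] ->
  induced_minor house G.
Proof.
move=> cX /= dX /and5P[ab bc cd de /andP[ae ad]] /and4P[/negPf ac /negPf bd /negPf be /negPf ce].
apply: (@list_model 5 _ G (nth set0 [:: a; b; c; d; e])) => [i i5|i j|i j].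
- by apply: cX; rewrite mem_nth.
- move: dX; rewrite !andbT => /and4P[/and4P[? ? ? ?] /and3P[? ? ?] /andP[? ?] ?].
  by case: i => [|[|[|[|[|i]]]]]; case: j => [|[|[|[|[|j]]]]].
by case: i => [|[|[|[|[|i]]]]]; case: j => [|[|[|[|[|j]]]]] => //= _ _; symmetry.
Qed.

(** * Graphs without a house *)

Section HouseFree.
Variable G : sgraph.
Hypothesis houseF : ~ induced_minor house G.
Implicit Types (S X A B : {set G}).

(** Let A1 be a maximal connected part of A that does not dominate S, and v a
    further vertex of A adjacent to A1; then A1 + v dominates S.  Some sv in S
    has no neighbour in A1 and is thus adjacent to v.  It turns out that at
    most one vertex of S is not adjacent to v, so v and one more vertex do. *)
Lemma house_free_dominated S A B : full_pair S A B ->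
  exists X, [/\ X \subset A, #|X| <= 2 & S \subset nbh X].
Proof.
move=> fp; have cA := fp_connl fp; have cB := fp_connr fp.
have nbhA X s : X \subset A -> s \in S -> touch [set s] X -> s \in nbh X.
  move=> /subsetP sXA sS t; rewrite inE t andbT.
  by apply: contra (fp_notl fp sS); apply: sXA.
have [a0 a0A] := conn_neq0 cA.
have [dom|ndom] := boolP (S \subset nbh [set a0]).
  by exists [set a0]; split; rewrite ?sub1set ?cards1.
(* Grow A1 from a single vertex until adding one more makes it dominate. *)
have [A1 [v [cA1 sA1 vA1 t1 [ndom1 dom2]]]] : exists A1 v,
    [/\ conn A1, v |: A1 \subset A, v \notin A1, touch [set v] A1 &
        ~~ (S \subset nbh A1) /\ S \subset nbh (v |: A1)].
  have sa0 : [set a0] \subset A by rewrite sub1set.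
  move: [set a0] (conn1 a0) sa0 ndom => X.
  have [n] := ubnP (#|A| - #|X|); elim: n X => // n IH X leX cX sXA ndX.
  have [s sS sX] := subsetPn ndX.
  have nAX : ~~ (A \subset X).
    apply: contra sX => sAX; have -> : X = A by apply/eqP; rewrite eqEsubset sXA.
    by rewrite (fp_nbhl fp).
  have [z zA zX] := subsetPn nAX.
  have [x xX] := conn_neq0 cX.
  have [p [v [pA vA pX vX pv]]] :=
    conn_exit (P := mem X) cA (subsetP sXA _ xX) xX zA zX.
  have tv : touch [set v] X.
    by apply/touchP; exists v, p; rewrite set11 sedge_sym.
  have svA : v |: X \subset A by rewrite subUset sub1set vA.
  have [domv|ndomv] := boolP (S \subset nbh (v |: X)); first by exists X, v.
  apply: (IH (v |: X)) => //; last exact: connU (conn1 v) cX tv.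
  have ltXA : #|v |: X| <= #|A| by apply: subset_leq_card.
  rewrite ltnS in leX; apply: leq_trans leX.
  have ltX : #|X| < #|v |: X| by rewrite cardsU1 (vX : v \notin X) add1n.
  by apply: ltn_sub2l => //; apply: leq_trans ltXA.
have [vA /subsetP sA1A] : v \in A /\ A1 \subset A.
  by move: sA1; rewrite subUset sub1set => /andP[].
have [sv svS svA1] := subsetPn ndom1.
have domE w : w \in S -> w -- v \/ touch [set w] A1.
  move=> /(subsetP dom2) /nbhP[_ [x /setU1P[->|xA1] wx]]; first by left.
  by right; apply/touchP; exists w, x; rewrite set11.
have nsv : ~~ touch [set sv] A1.
  by apply: contra svA1; apply: nbhA => //; apply/subsetP.
have svv : sv -- v by case: (domE _ svS) => // t; rewrite t in nsv.
have tB w : w \in S -> touch [set w] B.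
  by move=> /(fp_adjr fp)[x xB wx]; apply/touchP; exists w, x; rewrite set11.
have nA1B : ~~ touch A1 B.
  by apply/touchPn=> x y /sA1A xA yB; apply: (fp_edge fp).
have nvB : ~~ touch [set v] B.
  by apply/touchPn=> x y /set1P-> yB; apply: (fp_edge fp).
have dA1B : [disjoint A1 & B].
  by apply: disjoint_intro => x /sA1A; apply: disjoint_contra (fp_disj fp).
have vB : v \notin B by apply/negP; apply: disjoint_contra (fp_disj fp) vA.
have SA1 w : w \in S -> w \notin A1.
  by move=> wS; apply: contra (fp_notl fp wS); apply: sA1A.
have Sv w : w \in S -> w != v.
  by move=> wS; apply: contraTneq wS => ->; apply/negP=> /(fp_notl fp); rewrite vA.
have SB := fp_notr fp.
have d11 x y : x != y -> [disjoint [set x] & [set y]] by rewrite disjoints1 inE.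
have d1A1 w : w \in S -> [disjoint [set w] & A1] by rewrite disjoints1; apply: SA1.
have d1B w : w \in S -> [disjoint [set w] & B] by rewrite disjoints1; apply: SB.
have dvB : [disjoint [set v] & B] by rewrite disjoints1.
have dvA1 : [disjoint [set v] & A1] by rewrite disjoints1.
(* A common neighbour w of sv and A1 would close the square w, A1, v, sv,
   with B on top of its edge between w and sv. *)
have caseI w : w \in S -> ~~ (w -- v) -> ~~ (w -- sv).
  move=> wS wv; apply/negP=> wsv; apply: houseF.
  have wA1 : touch [set w] A1 by case: (domE w wS) => // wv'; rewrite wv' in wv.
  have wsvn : w != sv by apply: contraTneq wsv => ->; rewrite sedge_irrefl.
  apply: (@house_minor _ [set w] A1 [set v] [set sv] B).
  - by move=> X; rewrite !inE => /or4P[|||/orP[]] /eqP->; try exact: conn1.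
  - by rewrite /= !andbT; do ![apply/andP; split];
      first [solve [auto] | rewrite disjoint_sym; auto].
  - rewrite wA1 touch_sym t1 (touch_sym [set v]) !touch11 svv wsv !tB //.
  rewrite touch11 wv touch_sym nsv nA1B nvB //.
(* Given two such vertices, one merges with B to form the square A1, v, sv,
   B + w', and the other is the roof over A1 and B + w'. *)
have uniq_w w w' : w \in S -> w' \in S -> ~~ (w -- v) -> ~~ (w' -- v) -> w = w'.
  move=> wS w'S wv w'v; apply/eqP/negPn/negP=> ww'; apply: houseF.
  have wA1 : touch [set w] A1 by case: (domE w wS) => // h; rewrite h in wv.
  have w'A1 : touch [set w'] A1 by case: (domE w' w'S) => // h; rewrite h in w'v.
  have wsv := caseI w wS wv.
  have wnsv : w != sv by apply: contraNneq wv => ->.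
  have w'nsv : w' != sv by apply: contraNneq w'v => ->.
  apply: (@house_minor _ A1 [set v] [set sv] (B :|: [set w']) [set w]).
  - move=> X; rewrite !inE => /or4P[|||/orP[]] /eqP->; try exact: conn1; first exact: cA1.
    by apply: connU => //; [exact: conn1|rewrite touch_sym tB].
  - have dBw' X : [disjoint X & B] -> [disjoint [set w'] & X] -> [disjoint X & B :|: [set w']].
      rewrite disjoint_sym -!setI_eq0 => h h'.
      by rewrite setIC setIUl setU_eq0 h.
    have w'w : w' != w by rewrite eq_sym.
    by rewrite /= !andbT; do ![apply/andP; split];
      first [solve [auto] | rewrite disjoint_sym; auto].
  - rewrite !touchUr !touchUl touch11 !(touch_sym A1) t1 w'A1 wA1 sedge_sym svv.
    by rewrite (tB sv) // (touch_sym B) (tB w) // !orbT.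
  rewrite !(touch_sym A1) nsv !touchUr !touch11 (negPf nvB) ![v -- _]sedge_sym w'v wv.
  by rewrite sedge_sym.
have [w0 /andP[w0S w0v]|allv] := pickP [pred w in S | ~~ (w -- v)]; last first.
  exists [set v]; split; rewrite ?sub1set ?cards1 //; apply/subsetP=> s sS.
  apply: nbhA; rewrite ?sub1set // touch11.
  by have := allv s; rewrite /= sS => /negbFE.
have [x xA w0x] := fp_adjl fp w0S.
exists [set v; x]; split; first by rewrite subUset !sub1set vA.
  by rewrite cards2; case: (_ != _).
apply/subsetP=> s sS; apply: nbhA; rewrite ?subUset ?sub1set ?vA // touchUr !touch11.
case: (boolP (s -- v)) => //= sv'; by rewrite (uniq_w s w0).
Qed.

Lemma house_free_count :
  num_minimal_separators G <= #|G|.+1 ^ (4 * 2).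
Proof.
apply: (@card_small_sets _ _ _ (fun X Y _ _ =>
  nbh (\bigcup_(y in Y) component (~: (X :|: nbh X)) y))) => S.
rewrite inE => /minimal_separator_full[A [B fp]].
have [X [sXA X2 dX]] := house_free_dominated fp.
have [b bB] := conn_neq0 (fp_connr fp).
exists X, [set b], set0, set0; rewrite cards1 cards0; split=> //.
by rewrite big_set1 (fp_comp fp) // (fp_nbhr fp).
Qed.

End HouseFree.

Lemma touchS (G : sgraph) (X X' Y Y' : {set G}) :
  X \subset X' -> Y \subset Y' -> touch X Y -> touch X' Y'.
Proof.
move=> /subsetP sX /subsetP sY /touchP[x [y [xX yY xy]]].
by apply/touchP; exists x, y; split; [exact: sX|exact: sY|].
Qed.

Lemma card_bigcup_leq (I T : finType) (P : {set I}) (F : I -> {set T}) (k : nat) :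
  (forall i, i \in P -> #|F i| <= k) -> #|\bigcup_(i in P) F i| <= #|P| * k.
Proof.
move=> Fk; apply: (@leq_trans (\sum_(i in P) #|F i|)).
  elim/big_rec2: _ => [|i n X _ leXn]; first by rewrite cards0.
  by apply: leq_trans (leq_card_setU _ _) _; rewrite leq_add2l.
by rewrite -sum_nat_const; apply: leq_sum.
Qed.

(** * Butterflies *)

(** C becomes the centre.  Since X is connected and components_of the neighbourhood of
    C twice, it splits into two adjacent parts that both touch C; the same holds
    for Y, and these two edges form the wings. *)
Lemma butterfly_minor (G : sgraph) (C X Y : {set G}) x1 x2 y1 y2 :
  conn C -> conn X -> conn Y ->
  [disjoint C & X] -> [disjoint C & Y] -> [disjoint X & Y] -> ~~ touch X Y ->
  [/\ x1 \in X, x2 \in X, x1 != x2, touch [set x1] C & touch [set x2] C] ->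
  [/\ y1 \in Y, y2 \in Y, y1 != y2, touch [set y1] C & touch [set y2] C] ->
  induced_minor butterfly G.
Proof.
move=> cC cX cY dCX dCY dXY aXY [x1X x2X x12 t1 t2] [y1Y y2Y y12 u1 u2].
have [X1 [X2 [cX1 cX2 xX1 xX2 [eX dX tX]]]] := conn_split cX x1X x2X x12.
have [Y1 [Y2 [cY1 cY2 yY1 yY2 [eY dY tY]]]] := conn_split cY y1Y y2Y y12.
have [sX1 sX2] : X1 \subset X /\ X2 \subset X by rewrite -eX subsetUl subsetUr.
have [sY1 sY2] : Y1 \subset Y /\ Y2 \subset Y by rewrite -eY subsetUl subsetUr.
have dsub (U U' V V' : {set G}) : U' \subset U -> V' \subset V -> [disjoint U & V] -> [disjoint U' & V'].
  by move=> /subsetP sU /subsetP sV d; apply: disjoint_intro => z /sU zU /sV; apply: disjoint_contra d zU.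
have nt (U V : {set G}) : U \subset X -> V \subset Y -> touch U V = false.
  by move=> sU sV; apply: contraNF aXY; apply: touchS.
have tC z (U : {set G}) : z \in U -> touch [set z] C -> touch U C.
  by move=> zU; apply: touchS => //; rewrite sub1set.
pose L : seq {set G} := [:: X1; X2; Y1; Y2; C].
apply: (@list_model 5 _ G (nth set0 L)) => [i i5|i j|i j].
- by case: i i5 => [|[|[|[|[|i]]]]].
- by case: i => [|[|[|[|[|i]]]]]; case: j => [|[|[|[|[|j]]]]] => //= _ _;
    first [exact: dsub dXY|rewrite disjoint_sym; first [exact: dsub dCX|exact: dsub dCY]].
by case: i => [|[|[|[|[|i]]]]]; case: j => [|[|[|[|[|j]]]]] => //= _ _; symmetry;
  first [exact: nt|exact: tC t1|exact: tC t2|exact: tC u1|exact: tC u2].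
Qed.

Section ButterflyFree.
Variable G : sgraph.
Hypothesis butterflyF : ~ induced_minor butterfly G.
Implicit Types (S P Q K W X Y A B : {set G}).

Section Terminals.
Variables A B : {set G}.
Hypotheses (cA : conn A) (cB : conn B).
Hypotheses (dAB : [disjoint A & B]) (aAB : ~~ touch A B).

(** The situation of a vertex s of the separator whose only neighbour in A
    is a. *)
Definition attached (a s : G) : Prop :=
  [/\ a \in A, s \notin A, s \notin B, touch [set s] B &
      forall x, x \in A -> s -- x = (x == a)].

Lemma attached_neq a b s t : attached a s -> attached b t -> a != b -> s != t.
Proof.
move=> [aA _ _ _ es] [_ _ _ _ et] ab; apply: contraNneq ab => st.
by move: (es a aA); rewrite st et // eqxx.
Qed.

(** The wings are X + sx and Y + sy, and the centre is C + sz + B.  Each of sx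
    and sy touches the centre through B, while X and Y touch it through C. *)
Lemma three_parts (X Y C : {set G}) x y z sx sy sz :
  conn X -> conn Y -> conn C -> X \subset A -> Y \subset A -> C \subset A ->
  [disjoint C & X] -> [disjoint C & Y] -> [disjoint X & Y] ->
  ~~ touch X Y -> touch X C -> touch Y C ->
  x \in X -> y \in Y -> z \in C ->
  attached x sx -> attached y sy -> attached z sz ->
  ~~ sx -- sy -> False.
Proof.
move=> cX cY cC /subsetP sXA /subsetP sYA /subsetP sCA dCX dCY dXY nXY tXC tYC.
move=> xX yY zC ax ay az nxy; apply: butterflyF.
have xy : x != y by apply: contraTneq xX => ->; apply/negP=> h; apply: (disjoint_contra dXY h yY).
have zx : z != x by apply: contraTneq zC => ->; apply/negP=> h; apply: (disjoint_contra dCX h xX).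
have zy : z != y by apply: contraTneq zC => ->; apply/negP=> h; apply: (disjoint_contra dCY h yY).
have sxy := attached_neq ax ay xy; have szx := attached_neq az ax zx.
have szy := attached_neq az ay zy.
move: ax ay az => [_ sxA sxB txB ex] [_ syA syB tyB ey] [_ szA szB tzB ez].
have tx : touch X [set sx].
  by apply/touchP; exists x, sx; rewrite set11 sedge_sym ex ?sXA ?eqxx.
have ty : touch Y [set sy].
  by apply/touchP; exists y, sy; rewrite set11 sedge_sym ey ?sYA ?eqxx.
have tz : touch C [set sz].
  by apply/touchP; exists z, sz; rewrite set11 sedge_sym ez ?sCA ?eqxx.
have hub (U : {set G}) su : (forall w, w \in U -> w \in A) -> [disjoint C & U] ->
    su \notin A -> su \notin B -> su != sz ->
    [disjoint C :|: [set sz] :|: B & U :|: [set su]].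
  move=> sUA dCU suA suB susz; apply: disjoint_intro => w.
  rewrite !inE => /orP[/orP[wC|/eqP->]|wB] /orP[wU|/eqP wsu].
  - exact: (disjoint_contra dCU wC wU).
  - by case/negP: suA; rewrite -wsu sCA.
  - by case/negP: szA; apply: sUA.
  - by case/eqP: susz.
  - exact: (disjoint_contra dAB (sUA _ wU) wB).
  by case/negP: suB; rewrite -wsu.
have two (U : {set G}) su : touch U C -> (forall w, w \in U -> w \in A) ->
    touch [set su] B -> su \notin A ->
    exists w, [/\ w \in U :|: [set su], su \in U :|: [set su], w != su,
      touch [set w] (C :|: [set sz] :|: B) & touch [set su] (C :|: [set sz] :|: B)].
  move=> /touchP[w [c [wU cC' wc]]] sUA suB suA; exists w; split.
  - by rewrite inE wU.
  - by rewrite !inE eqxx orbT.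
  - by apply: contraTneq wU => ->; apply/negP=> /sUA; rewrite (negPf suA).
  - by rewrite !touchUr; apply/orP; left; apply/orP; left; apply/touchP; exists w, c; rewrite set11.
  - by rewrite !touchUr suB orbT.
have [wx twox] := two X sx tXC sXA txB sxA.
have [wy twoy] := two Y sy tYC sYA tyB syA.
apply: (butterfly_minor (C := C :|: [set sz] :|: B) _ _ _ _ _ _ _ twox twoy).
- apply: connU => //; first by apply: connU => //; apply: conn1.
  by rewrite touchUl tzB orbT.
- by apply: connU => //; apply: conn1.
- by apply: connU => //; apply: conn1.
- by apply: hub => //; rewrite eq_sym.
- by apply: hub => //; rewrite eq_sym.
- apply: disjoint_intro => w; rewrite !inE => /orP[wX|/eqP->] /orP[wY|/eqP wsy].
  + exact: (disjoint_contra dXY wX wY).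
  + by case/negP: syA; rewrite -wsy sXA.
  + by case/negP: sxA; apply: sYA.
  + by case/eqP: sxy.
have nX : ~~ touch X [set sy].
  apply/touchPn=> w _ wX /set1P->; rewrite sedge_sym ey ?sXA //.
  by apply/eqP=> wy'; apply: (disjoint_contra dXY wX); rewrite wy'.
have nY : ~~ touch [set sx] Y.
  apply/touchPn=> _ w /set1P-> wY; rewrite ex ?sYA //.
  by apply/eqP=> wx'; apply: (@disjoint_contra _ _ _ x dXY xX); rewrite -wx'.
by rewrite !touchUl !touchUr touch11 !negb_or nXY nX nY nxy.
Qed.

(** Suppose x and y are not adjacent and let Z be the component of z in
    A minus x and y.  If Z touches both x and y, then {x}, {y} and Z are three
    parts as above, with centre Z.  If Z misses b, one of x and y, then it
    touches the other one, a; the parts are Z, {b} and the component of a in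
    what remains, which touches b because A is connected. *)
Lemma terminals_adjacent x y z sx sy sz :
  x != y -> x != z -> y != z ->
  attached x sx -> attached y sy -> attached z sz ->
  ~~ sx -- sy -> ~~ sx -- sz -> ~~ sy -- sz -> x -- y.
Proof.
move=> xy xz yz ax ay az nxy nxz nyz; apply/negPn/negP=> xny.
pose Z := component (A :\: [set x; y]) z.
have [xA _ _ _ _] := ax; have [yA _ _ _ _] := ay; have [zA _ _ _ _] := az.
have zA' : z \in A :\: [set x; y] by rewrite !inE negb_or !(eq_sym z) xz yz.
have sZ := subsetP (component_sub zA').
have sZA : Z \subset A by apply/subsetP=> w /sZ /setDP[].
have xZ : x \notin Z by apply/negP=> /sZ; rewrite !inE eqxx.
have yZ : y \notin Z by apply/negP=> /sZ; rewrite !inE eqxx orbT.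
have cZ : conn Z by apply: component_conn.
have zZ : z \in Z by apply: component_refl.
have exitZ u v : u \in Z -> v \in A -> v \notin Z -> u -- v -> (v == x) || (v == y).
  move=> uZ vA vZ uv; apply: contraNT vZ => nv.
  by apply: (component_closed uZ) uv; [exact: sZ|rewrite in_setD vA !inE nv].
have side a b sa sb : a != b -> [set a; b] = [set x; y] ->
  attached a sa -> attached b sb -> ~~ sb -- sz ->
  ~~ touch [set b] Z -> ~~ touch [set a] [set b] -> False.
- move=> ab eab aa bb nbz ntb ntab.
  have {}exitZ u v : u \in Z -> v \in A -> v \notin Z -> u -- v -> v == a.
    move=> uZ vA vZ uv; have := exitZ u v uZ vA vZ uv.
    rewrite -!in_set1 -in_setU -eab !inE => /orP[//|/eqP vb].
    by case/negP: ntb; apply/touchP; exists b, u; rewrite set11 -vb sedge_sym.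
  have [aA bA] : a \in A /\ b \in A by case: aa; case: bb.
  have [aZ bZ] : a \notin Z /\ b \notin Z.
    have /set2P ax' : a \in [set x; y] by rewrite -eab !inE eqxx.
    have /set2P bx' : b \in [set x; y] by rewrite -eab !inE eqxx orbT.
    by case: ax' => ->; case: bx' => ->.
  have tZa : touch Z [set a].
    have [u [v [_ vA uZ vZ uv]]] := conn_exit (P := mem Z) cA zA zZ aA aZ.
    apply/touchP; exists u, v; split=> //; rewrite inE; exact: exitZ vA vZ uv.
  pose D := component (A :\: (Z :|: [set b])) a.
  have aA' : a \in A :\: (Z :|: [set b]).
    by rewrite in_setD in_setU negb_or aZ inE ab.
  have sD := subsetP (component_sub aA').
  have sDA : D \subset A by apply/subsetP=> w /sD /setDP[].
  have aD : a \in D by apply: component_refl.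
  have DZ w : w \in D -> w \notin Z.
    by move=> /sD; rewrite in_setD in_setU negb_or => /andP[/andP[]].
  have bD : b \notin D.
    by apply/negP=> /sD; rewrite in_setD in_setU set11 orbT.
  have tbD : touch [set b] D.
    pose U := [pred w | (w \in Z) || (w \in D)].
    have Ua : U a by rewrite /= aD orbT.
    have Ub : ~~ U b by rewrite /= negb_or bZ.
    have [u [v [_ vA Uu Uv uv]]] := conn_exit cA aA Ua bA Ub.
    move: Uv; rewrite /= negb_or => /andP[vZ vD].
    case/orP: Uu => [uZ|uD].
      by have /eqP va := exitZ u v uZ vA vZ uv; rewrite va aD in vD.
    have [vb|vb] := eqVneq v b.
      by apply/touchP; exists b, u; rewrite set11 -vb sedge_sym.
    case/negP: vD; apply: (component_closed uD) uv; first exact: sD.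
    by rewrite in_setD in_setU negb_or vZ inE vb.
  apply: (@three_parts Z [set b] D z b a sz sb sa) => //.
  - exact: conn1.
  - exact: component_conn.
  - by rewrite sub1set.
  - by apply: disjoint_intro => w /DZ /negP.
  - by rewrite disjoint_sym disjoints1.
  - by rewrite disjoint_sym disjoints1.
  - by rewrite touch_sym.
  - by apply: touchS tZa => //; rewrite sub1set.
  - exact: set11.
  - by rewrite sedge_sym.
have [txZ|] := boolP (touch [set x] Z); last first.
  move=> ntx; apply: (side y x sy sx) => //.
  - by rewrite eq_sym.
  - by rewrite setUC.
  - by rewrite touch11 sedge_sym.
have [tyZ|] := boolP (touch [set y] Z); last first.
  by move=> nty; apply: (side x y sx sy) => //; rewrite touch11.
apply: (@three_parts [set x] [set y] Z x y z sx sy sz) => //; rewrite ?sub1set ?set11 //.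
- exact: conn1.
- exact: conn1.
- by rewrite disjoint_sym disjoints1.
- by rewrite disjoint_sym disjoints1.
- by rewrite disjoints1 inE.
by rewrite touch11.
Qed.

(** The wings are the edge a1 a2 and the set B + s3 + s4, and the centre is the
    edge a3 a4, which is joined to the second wing at s3 and at s4. *)
Lemma four_terminals a1 a2 a3 a4 s3 s4 :
  uniq [:: a1; a2; a3; a4] -> a1 \in A -> a2 \in A -> a1 -- a2 -> a3 -- a4 ->
  a1 -- a3 -> a2 -- a3 -> attached a3 s3 -> attached a4 s4 -> False.
Proof.
rewrite /= !inE !negb_or !andbT => /and3P[/and3P[n12 n13 n14] /andP[n23 n24] n34].
move=> a1A a2A e12 e34 e13 e23 at3 at4; apply: butterflyF.
have s34 := attached_neq at3 at4 n34.
move: at3 at4 => [a3A s3A s3B t3 e3] [a4A s4A s4B t4 e4].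
apply: (butterfly_minor (C := [set a3] :|: [set a4]) (X := [set a1] :|: [set a2])
  (Y := [set s3] :|: B :|: [set s4]) (x1 := a1) (x2 := a2) (y1 := s3) (y2 := s4)).
- by apply: connU; rewrite ?touch11 //; apply: conn1.
- by apply: connU; rewrite ?touch11 //; apply: conn1.
- apply: connU; [|exact: conn1|by rewrite touchUl (touch_sym B) t4 orbT].
  by apply: connU => //; apply: conn1.
- apply: disjoint_intro => w; rewrite !inE => /orP[]/eqP->.
    by rewrite !(eq_sym a3) (negPf n13) (negPf n23).
  by rewrite !(eq_sym a4) (negPf n14) (negPf n24).
- apply: disjoint_intro => w; rewrite !inE => w34.
  have wA : w \in A by case/orP: w34 => /eqP->.
  case/orP=> [/orP[/eqP ws|wB]|/eqP ws]; rewrite ?ws in wA.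
  + by rewrite wA in s3A.
  + exact: disjoint_contra dAB wA wB.
  + by rewrite wA in s4A.
- apply: disjoint_intro => w; rewrite !inE => w34.
  have wA : w \in A by case/orP: w34 => /eqP->.
  case/orP=> [/orP[/eqP ws|wB]|/eqP ws]; rewrite ?ws in wA.
  + by rewrite wA in s3A.
  + exact: disjoint_contra dAB wA wB.
  + by rewrite wA in s4A.
- apply/touchPn=> u w; rewrite !inE => u12.
  have uA : u \in A by case/orP: u12 => /eqP->.
  case/orP=> [/orP[/eqP->|wB]|/eqP->].
  + rewrite sedge_sym e3 //; case/orP: u12 => /eqP->; exact: negbTE.
  + by move/touchPn: aAB; apply.
  + rewrite sedge_sym e4 //; case/orP: u12 => /eqP->; exact: negbTE.
- by split; rewrite ?touchUr ?touch11 ?inE ?eqxx ?orbT ?e13 ?e23.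
by split; rewrite ?touchUr ?touch11 ?(e3 _ a3A) ?(e4 _ a4A) ?inE ?eqxx ?orbT.
Qed.

(** Any two terminals are adjacent as soon as there is a third one, and four
    pairwise adjacent terminals give a butterfly. *)
Lemma terminals_bound (P K : {set G}) :
  (forall a, a \in P -> exists2 s, s \in K & attached a s) ->
  (forall a b s t, a != b -> s \in K -> t \in K -> attached a s -> attached b t ->
    ~~ s -- t) ->
  #|P| <= 3.
Proof.
move=> hP hK; rewrite leqNgt cardE; apply/negP.
have := enum_uniq P; have sub a : a \in enum P -> a \in P by rewrite mem_enum.
move: (enum P) sub => [|a1 [|a2 [|a3 [|a4 L]]]] // sub U _.
have {U} U : uniq [:: a1; a2; a3; a4].
  by move: U; rewrite -[_ :: _]/([:: a1; a2; a3; a4] ++ L) cat_uniq => /and3P[].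
have [|s1 K1 at1] := hP a1; first by apply: sub; rewrite !inE eqxx.
have [|s2 K2 at2] := hP a2; first by apply: sub; rewrite !inE eqxx ?orbT.
have [|s3 K3 at3] := hP a3; first by apply: sub; rewrite !inE eqxx ?orbT.
have [|s4 K4 at4] := hP a4; first by apply: sub; rewrite !inE eqxx ?orbT.
have := U; rewrite /= !inE !negb_or !andbT => /and3P[/and3P[n12 n13 n14] /andP[n23 n24] n34].
have [a1A _ _ _ _] := at1; have [a2A _ _ _ _] := at2.
have symN (a b : G) : a != b -> b != a by rewrite eq_sym.
have adj a b c s t r : s \in K -> t \in K -> r \in K ->
    attached a s -> attached b t -> attached c r ->
    a != b -> a != c -> b != c -> a -- b.
  move=> sK tK rK ats att atr ab ac bc.
  by apply: (terminals_adjacent ab ac bc ats att atr);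
    [exact: (hK a b)|exact: (hK a c)|exact: (hK b c)].
apply: (four_terminals U a1A a2A _ _ _ _ at3 at4).
- exact: adj K1 K2 K3 at1 at2 at3 n12 n13 n23.
- by apply: (adj _ _ _ _ _ _ K3 K4 K1 at3 at4 at1); auto.
- by apply: (adj _ _ _ _ _ _ K1 K3 K2 at1 at3 at2); auto.
- by apply: (adj _ _ _ _ _ _ K2 K3 K1 at2 at3 at1); auto.
Qed.

End Terminals.

Section HubTypes.
Variables A B : {set G}.
Hypotheses (cA : conn A) (cB : conn B).
Hypotheses (dAB : [disjoint A & B]) (aAB : ~~ touch A B).

(** Otherwise C is the centre of a butterfly with wings A and B. *)
Lemma hub_small C : conn C -> [disjoint C & A] -> [disjoint C & B] ->
  (#|[set a in A | touch [set a] C]| <= 1) || (#|[set b in B | touch [set b] C]| <= 1).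
Proof.
move=> cC dCA dCB; rewrite -[_ || _]negbK negb_or -!ltnNge; apply/negP.
case/andP=> /card_gt1P[a1 [a2 [+ + a12]]] /card_gt1P[b1 [b2 [+ + b12]]].
rewrite !inE => /andP[a1A ta1] /andP[a2A ta2] /andP[b1B tb1] /andP[b2B tb2].
by apply: butterflyF; apply: (@butterfly_minor G C A B a1 a2 b1 b2).
Qed.

End HubTypes.

Section Representatives.
Variable W : {set G}.

(** The components of v1 and v2 are the wings; {p, q} and the component of v3
    form the centre.  Each component is attached to the centre at v and at some
    neighbour of q, which differs from v because v is not adjacent to q. *)
Lemma three_components p q v1 v2 v3 :
  p \notin W -> q \notin W ->
  (forall v, v \in [:: v1; v2; v3] ->
     [/\ v \in W, v -- p, ~~ v -- q & touch [set q] (component W v)]) ->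
  v2 \notin component W v1 -> v3 \notin component W v1 ->
  v3 \notin component W v2 -> False.
Proof.
move=> pW qW hv n21 n31 n32; apply: butterflyF.
have [|v1W v1p v1q t1] := hv v1; first by rewrite !inE eqxx.
have [|v2W v2p v2q t2] := hv v2; first by rewrite !inE eqxx orbT.
have [|v3W v3p v3q t3] := hv v3; first by rewrite !inE eqxx !orbT.
have dis v w : w \notin component W v -> [disjoint component W v & component W w].
  move=> nwv; apply: disjoint_intro => z zv zw; case/negP: nwv.
  by rewrite -(component_eq zv) component_sym.
have sub v : v \in W -> {subset component W v <= W}.
  by move=> vW; apply/subsetP/component_sub.
have dhub v : v \in W -> v3 \notin component W v ->
    [disjoint component W v3 :|: [set p] :|: [set q] & component W v].
  move=> vW n3v; apply: disjoint_intro => z; rewrite in_setU in_setU !in_set1.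
  case/orP=> [/orP[z3|/eqP->]|/eqP->].
  - by move=> zv; apply: (disjoint_contra (dis _ _ n3v) zv z3).
  - by move/(sub _ vW); rewrite (negPf pW).
  - by move/(sub _ vW); rewrite (negPf qW).
have two v : v -- p -> ~~ v -- q -> touch [set q] (component W v) ->
    exists w, [/\ v \in component W v, w \in component W v, v != w,
      touch [set v] (component W v3 :|: [set p] :|: [set q]) &
      touch [set w] (component W v3 :|: [set p] :|: [set q])].
  move=> vp vq /touchP[_ [w [/set1P-> wv qw]]]; exists w; split=> //.
  - exact: component_refl.
  - by apply: contraNneq vq => ->; rewrite sedge_sym.
  - by rewrite !touchUr touch11 vp orbT.
  - by rewrite !touchUr !touch11 (sedge_sym w q) qw orbT.
have [w1 two1] := two v1 v1p v1q t1.
have [w2 two2] := two v2 v2p v2q t2.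
apply: (butterfly_minor (C := component W v3 :|: [set p] :|: [set q])
  _ _ _ _ _ _ _ two1 two2).
- apply: connU; [|exact: conn1|by rewrite touchUl touch_sym t3].
  apply: connU; [exact: component_conn|exact: conn1|].
  by apply/touchP; exists v3, p; rewrite component_refl set11.
- exact: component_conn.
- exact: component_conn.
- exact: dhub.
- exact: dhub.
- exact: dis.
apply/touchPn=> x y x1 y2; apply/negP=> xy.
have y1 : y \in component W v1.
  by apply: (component_closed x1) xy; [exact: sub x1|exact: sub y2].
exact: (disjoint_contra (dis _ _ n21) y1 y2).
Qed.

(** Choose representatives greedily: a third choice is impossible. *)
Lemma two_representatives p q K :
  p \notin W -> q \notin W ->
  (forall v, v \in K ->
     [/\ v \in W, v -- p, ~~ v -- q & touch [set q] (component W v)]) ->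
  exists X, [/\ X \subset K, #|X| <= 2 &
    forall v, v \in K -> exists2 x, x \in X & v \in component W x].
Proof.
move=> pW qW hK.
have [v1 v1K|K0] := pickP (mem K); last first.
  by exists set0; split; rewrite ?sub0set ?cards0 // => v vK; have := K0 v; rewrite /= vK.
have [v2 /andP[v2K n21]|all1] := pickP [pred v in K | v \notin component W v1]; last first.
  exists [set v1]; split; rewrite ?sub1set ?cards1 // => v vK; exists v1; rewrite ?set11 //.
  by have := all1 v; rewrite /= vK => /negbFE.
exists [set v1; v2]; split; first by rewrite subUset !sub1set; apply/andP.
  by rewrite cards2; case: (_ != _).
move=> v vK; have [vv1|n1] := boolP (v \in component W v1).
  by exists v1; rewrite ?set21.
have [vv2|n2] := boolP (v \in component W v2); first by exists v2; rewrite ?set22.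
exfalso; apply: (three_components pW qW _ n21 n1 n2) => w.
by rewrite !inE => /or3P[]/eqP->; apply: hK.
Qed.

Lemma representatives P Q K :
  [disjoint P & W] -> [disjoint Q & W] ->
  (forall v, v \in K ->
     [/\ v \in W, touch [set v] P, ~~ touch [set v] Q & touch Q (component W v)]) ->
  exists X, [/\ X \subset K, #|X| <= #|P| * (#|Q| * 2) &
    forall v, v \in K -> exists2 x, x \in X & v \in component W x].
Proof.
move=> dP dQ hK.
pose Kpq (pq : G * G) :=
  [set v in K | (v -- pq.1) && touch [set pq.2] (component W v)].
have reps (pq : G * G) : exists X : {set G}, pq.1 \in P -> pq.2 \in Q ->
    [/\ X \subset Kpq pq, #|X| <= 2 &
    forall v, v \in Kpq pq -> exists2 x, x \in X & v \in component W x].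
  have [/andP[pP qQ]|npq] := boolP ((pq.1 \in P) && (pq.2 \in Q)); last first.
    by exists set0 => pP qQ; rewrite pP qQ in npq.
  have [||v|X hX] := @two_representatives pq.1 pq.2 (Kpq pq); last by exists X.
  - by apply/negP; apply: disjoint_contra dP pP.
  - by apply/negP; apply: disjoint_contra dQ qQ.
  rewrite inE => /andP[/hK[vW _ nvQ _] /andP[vp tq]]; split=> //.
  by apply: contra nvQ => vq; apply/touchP; exists v, pq.2; rewrite set11.
have [h hP] := fin_all_exists reps.
exists (\bigcup_(p in P) \bigcup_(q in Q) h (p, q)); split.
- apply/bigcupsP=> p pP; apply/bigcupsP=> q qQ.
  have [sub _ _] := hP (p, q) pP qQ; apply: subset_trans sub _.
  by apply/subsetP=> v; rewrite inE => /andP[].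
- apply: card_bigcup_leq => p pP; apply: card_bigcup_leq => q qQ.
  by have [_ ? _] := hP (p, q) pP qQ.
move=> v vK; have [vW /touchP[_ [p [/set1P-> pP vp]]] nvQ] := hK v vK.
move=> /touchP[q [w [qQ wv qw]]].
have [_ _ /(_ v)] := hP (p, q) pP qQ.
case; first by rewrite inE vK vp; apply/touchP; exists q, w; rewrite set11.
by move=> x xh vx; exists x => //; apply/bigcupP; exists p => //; apply/bigcupP; exists q.
Qed.

End Representatives.

End ButterflyFree.

(** * Separators of graphs without a butterfly *)

Section ButterflyCount.
Variable G : sgraph.
Hypothesis butterflyF : ~ induced_minor butterfly G.
Implicit Types (S P Q X Y A B : {set G}).

Definition components_of W X : {set G} := \bigcup_(x in X) component W x.

(** How S is recovered.  P and Q are the attachment vertices in A and in B, X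
    marks components of W on the side of B, where S consists of neighbours of
    P, and Y marks components on the side of A.  A vertex adjacent to both P
    and Q lies in S whichever side it is on, so that components where the
    neighbours of P and of Q coincide need no mark. *)
Definition separator_of_code P Q X Y : {set G} :=
  let W := ~: (P :|: Q) in
  [set v in W | [|| touch [set v] P && touch [set v] Q,
                    touch [set v] P && (v \in components_of W X) |
                    touch [set v] Q && (v \in components_of W Y)]].

Section Decomposition.
Variables S A B : {set G}.
Hypothesis fp : full_pair S A B.

Let M := ~: (A :|: B).
Let cA := fp_connl fp.
Let cB := fp_connr fp.
Let dAB := fp_disj fp.
Let aAB := fp_anti fp.

(** The component of v outside A and B has at most one neighbour in Z, where Z
    is A or B. *)
Definition few_nbrs (Z : {set G}) v : bool :=
  #|[set a in Z | touch [set a] (component M v)]| <= 1.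

Let inM v : (v \in M) = (v \notin A) && (v \notin B).
Proof. by rewrite in_setC in_setU negb_or. Qed.

Lemma few_nbrs_or v : v \in M -> few_nbrs A v || few_nbrs B v.
Proof.
move=> vM; have /subsetP sub := component_sub vM.
apply: (hub_small butterflyF cA cB dAB aAB); first exact: component_conn.
  by apply: disjoint_intro => z /sub; rewrite inM => /andP[/negP].
by apply: disjoint_intro => z /sub; rewrite inM => /andP[_ /negP].
Qed.

Lemma few_nbrs_edge Z u v : u \in M -> v \in M -> u -- v -> few_nbrs Z u = few_nbrs Z v.
Proof.
move=> uM vM uv; rewrite /few_nbrs; congr (#|pred_of_set _| <= 1); apply/setP=> a.
rewrite !inE (@component_eq _ M u v) //.
by apply: (component_closed (component_refl M u)).
Qed.

Lemma few_nbrs_uniq (Z : {set G}) v a b : few_nbrs Z v -> a \in Z -> b \in Z ->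
  touch [set a] (component M v) -> touch [set b] (component M v) -> a = b.
Proof.
by move=> /card_le1_eqP h aZ bZ ta tb; apply: h; rewrite inE ?aZ ?bZ.
Qed.

Lemma in_separator v a : v \in M -> (a \in A) || (a \in B) -> v -- a -> v \in S.
Proof.
rewrite inM => /andP[vA vB] /orP[aA|aB] va; first exact: (fp_inl fp vA aA).
exact: (fp_inr fp vB aB).
Qed.

End Decomposition.

Lemma few_nbrs_sym A B Z v : few_nbrs A B Z v = few_nbrs B A Z v.
Proof. by rewrite /few_nbrs setUC. Qed.

(** Vertices of S in components with a single neighbour in A are attached to
    it in the above sense.  Two with different neighbours lie in different
    components, hence are not adjacent. *)
Lemma attachment_bound S A B (T : pred G) : full_pair S A B ->
  (forall v, v \in ~: (A :|: B) -> T v -> few_nbrs A B A v) ->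
  #|[set a in A | [exists v in ~: (A :|: B), T v && (a -- v)]]| <= 3.
Proof.
move=> fp hT; have cA := fp_connl fp; have cB := fp_connr fp.
have inM v : (v \in ~: (A :|: B)) = (v \notin A) && (v \notin B).
  by rewrite in_setC in_setU negb_or.
apply: (terminals_bound butterflyF cA cB (fp_disj fp) (fp_anti fp)
  (K := [set v in ~: (A :|: B) | T v])).
  move=> a; rewrite inE => /andP[aA /existsP[v /and3P[vM Tv av]]].
  exists v; first by rewrite inE vM.
  have vS : v \in S by apply: (in_separator fp vM (a := a)); rewrite ?aA // sedge_sym.
  split=> //; [exact: (fp_notl fp vS)|exact: (fp_notr fp vS)| |].
    by have [x xB vx] := fp_adjr fp vS; apply/touchP; exists v, x; rewrite set11.
  move=> x xA; apply/idP/eqP=> [vx|->]; last by rewrite sedge_sym.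
  apply: (few_nbrs_uniq (hT v vM Tv) xA aA); apply/touchP.
    by exists x, v; rewrite set11 component_refl sedge_sym.
  by exists a, v; rewrite set11 component_refl.
move=> a b s t ab; rewrite !inE => /andP[sM Ts] /andP[tM Tt] [aA _ _ _ es] [bA _ _ _ et].
rewrite -in_setU -in_setC in sM; rewrite -in_setU -in_setC in tM.
apply: contraNN ab => st; apply/eqP; apply: (few_nbrs_uniq (hT s sM Ts) aA bA); apply/touchP.
  by exists a, s; rewrite set11 component_refl sedge_sym es // eqxx.
exists b, t; rewrite set11 sedge_sym et // eqxx; split=> //.
by apply: component_closed st => //; apply: component_refl.
Qed.

(** A neighbour w of v in B lies outside Q, hence in W.  As B is connected, the
    component of w reaches Q before it leaves B. *)
Lemma touch_component A B P Q W v : conn B -> [disjoint A & B] ->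
  P \subset A -> Q \subset B -> Q != set0 -> W = ~: (P :|: Q) ->
  v \in W -> (exists2 w, w \in B & v -- w) -> ~~ touch [set v] Q ->
  touch Q (component W v).
Proof.
move=> cB dAB /subsetP PA /subsetP QB /set0Pn[q qQ] eW vW [w wB vw] nvQ.
have BW z : z \in B -> z \notin Q -> z \in W.
  move=> zB zQ; rewrite eW in_setC in_setU negb_or zQ andbT.
  by apply/negP=> /PA zA; apply: (disjoint_contra dAB zA zB).
have wQ : w \notin Q by apply: contra nvQ => wQ; apply/touchP; exists v, w; rewrite set11.
have wv : w \in component W v.
  by apply: component_closed vw => //; [exact: component_refl|exact: BW].
have qv : q \notin component W v.
  by apply/negP=> /(subsetP (component_sub vW)); rewrite eW in_setC in_setU qQ orbT.
have [x [y [xB yB xv yv xy]]] := conn_exit (P := mem (component W v)) cB wB wv (QB _ qQ) qv.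
apply/touchP; exists y, x; rewrite sedge_sym; split=> //.
apply: contraNT yv => yQ; apply: component_closed xy => //; last exact: BW.
exact: (subsetP (component_sub vW)).
Qed.

(** Call a vertex outside A and B of type A when its component there has at most
    one neighbour in A; the others have at most one neighbour in B.  The side of
    B in W consists of the rest of B and the vertices of type A: these have
    their neighbours in A inside P, and the remaining ones have their neighbours
    in B inside Q, so no edge of W leaves this side. *)
Lemma butterfly_free_code S A B : full_pair S A B ->
  exists P Q X Y : {set G},
    [/\ #|P| <= 32, #|Q| <= 32, #|X| <= 32, #|Y| <= 32 & S = separator_of_code P Q X Y].
Proof.
move=> fp; have fp' := full_pair_sym fp.
have cA := fp_connl fp; have cB := fp_connr fp.
have dAB := fp_disj fp; have dBA := fp_disj fp'.
pose M := ~: (A :|: B); have eM : ~: (B :|: A) = M by rewrite setUC.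
have inM v : (v \in M) = (v \notin A) && (v \notin B).
  by rewrite in_setC in_setU negb_or.
pose tA := few_nbrs A B A.
have [p0 p0A] := conn_neq0 cA; have [q0 q0B] := conn_neq0 cB.
pose P0 := [set a in A | [exists v in M, tA v && (a -- v)]].
pose Q0 := [set b in B | [exists v in M, ~~ tA v && (b -- v)]].
(* p0 and q0 make P and Q nonempty, so that the connected sets A and B reach
   them from each of their vertices. *)
pose P := p0 |: P0; pose Q := q0 |: Q0.
have P4 : #|P| <= 4.
  apply: leq_trans (leq_card_setU _ _) _; rewrite cards1 ltnS.
  exact: (attachment_bound fp).
have Q4 : #|Q| <= 4.
  apply: leq_trans (leq_card_setU _ _) _; rewrite cards1 ltnS.
  rewrite /Q0 -eM; apply: (attachment_bound fp') => v; rewrite eM => vM ntA.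
  by rewrite -few_nbrs_sym; have := few_nbrs_or fp vM; rewrite -/(tA v) (negPf ntA).
have sPA : P \subset A by rewrite subUset sub1set p0A; apply/subsetP=> a; rewrite inE => /andP[].
have sQB : Q \subset B by rewrite subUset sub1set q0B; apply/subsetP=> a; rewrite inE => /andP[].
have PA := subsetP sPA; have QB := subsetP sQB.
have inP a v : a \in A -> v \in M -> tA v -> v -- a -> a \in P.
  move=> aA vM tv va; rewrite in_setU1 inE aA; apply/orP; right; apply/existsP.
  by exists v; rewrite vM tv sedge_sym.
have inQ b v : b \in B -> v \in M -> ~~ tA v -> v -- b -> b \in Q.
  move=> aA vM tv va; rewrite in_setU1 inE aA; apply/orP; right; apply/existsP.
  by exists v; rewrite vM tv sedge_sym.
pose W := ~: (P :|: Q).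
have inW v : (v \in W) = (v \notin P) && (v \notin Q) by rewrite in_setC in_setU negb_or.
have SM v : v \in S -> v \in M by move=> vS; rewrite inM (fp_notl fp) // (fp_notr fp).
have MW v : v \in M -> v \in W.
  rewrite inM inW => /andP[vA vB]; apply/andP; split; first exact: contra (PA v) vA.
  exact: contra (QB v) vB.
have toP v : v \in S -> tA v -> touch [set v] P.
  move=> vS tv; have [a aA va] := fp_adjl fp vS; apply/touchP; exists v, a.
  by rewrite set11; split=> //; apply: inP va => //; apply: SM.
have toQ v : v \in S -> ~~ tA v -> touch [set v] Q.
  move=> vS tv; have [a aA va] := fp_adjr fp vS; apply/touchP; exists v, a.
  by rewrite set11; split=> //; apply: inQ va => //; apply: SM.
have dPW : [disjoint P & W] by apply: disjoint_intro => z zP; rewrite inW zP.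
have dQW : [disjoint Q & W] by apply: disjoint_intro => z zP; rewrite inW zP andbF.
have P0' : P != set0 by apply/set0Pn; exists p0; rewrite setU11.
have Q0' : Q != set0 by apply/set0Pn; exists q0; rewrite setU11.
have [||v|X [XK Xcard hX]] := @representatives G butterflyF W P Q
    [set v in S | tA v && ~~ touch [set v] Q] => //.
  rewrite inE => /and3P[vS tv nvQ]; split=> //; [exact/MW/SM|exact: toP|].
  exact: (touch_component cB dAB sPA sQB Q0' (erefl W) (MW _ (SM _ vS)) (fp_adjr fp vS)).
have [||v|Y [YK Ycard hY]] := @representatives G butterflyF W Q P
    [set v in S | ~~ tA v && ~~ touch [set v] P] => //.
  rewrite inE => /and3P[vS tv nvQ]; split=> //; [exact/MW/SM|exact: toQ|].
  apply: (touch_component cA dBA sQB sPA P0' _ (MW _ (SM _ vS)) (fp_adjl fp vS)) => //.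
  by rewrite setUC.
have le32 a b : a <= 4 -> b <= 4 -> a * (b * 2) <= 32.
  by move=> a4 b4; apply: (@leq_mul a _ 4 8) => //; apply: (@leq_mul b _ 4 2).
exists P, Q, X, Y; split.
- exact: leq_trans P4 _.
- exact: leq_trans Q4 _.
- exact: leq_trans Xcard (le32 _ _ P4 Q4).
- exact: leq_trans Ycard (le32 _ _ Q4 P4).
have sideE u v : u \in W -> v \in W -> u -- v ->
    ((u \in B) || (u \in M) && tA u) = ((v \in B) || (v \in M) && tA v).
  have half x y : x \in W -> y \in W -> x -- y ->
    (x \in B) || (x \in M) && tA x -> (y \in B) || (y \in M) && tA y.
    move=> xW yW xy.
    have [yB|yB] //= := boolP (y \in B).
    case/orP=> [xB|/andP[xM tx]].
      have yA : y \notin A.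
        by apply/negP=> yA; move: (fp_edge fp yA xB); rewrite sedge_sym xy.
      have yM : y \in M by rewrite inM yA.
      rewrite yM /=; apply: contraLR xW => ty; rewrite inW.
      by rewrite (inQ x y) ?andbF // sedge_sym.
    have [yA|yA] := boolP (y \in A).
      by have yP := inP _ _ yA xM tx xy; rewrite inW yP in yW.
    have yM : y \in M by rewrite inM yA.
    by rewrite yM /=; rewrite /tA -(few_nbrs_edge _ xM yM xy).
  by move=> uW vW uv; apply/idP/idP; apply: half => //; rewrite sedge_sym.
pose side v := (v \in B) || (v \in M) && tA v.
have sideC x v : v \in component W x -> side x = side v.
  move=> vx; apply/eqP; apply: (component_ind (P := fun z => side x == side z) vx) => //.
  by move=> u w uW wW /eqP-> uw; apply/eqP; apply: sideE.
have sideS v : v \in S -> side v = tA v.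
  by move=> vS; rewrite /side (SM _ vS) (negPf (fp_notr fp vS)).
apply/setP=> v; rewrite inE -/W; apply/idP/andP.
  move=> vS; split; first exact/MW/SM.
  have [tv|tv] := boolP (tA v).
    rewrite (toP v vS tv) /=; case: (boolP (touch [set v] Q)) => //= nvQ.
    have [|x xX vx] := hX v; first by rewrite inE vS tv.
    by rewrite orbF; apply/bigcupP; exists x.
  rewrite (toQ v vS tv) andbT /=; case: (boolP (touch [set v] P)) => //= nvP.
  have [|x xX vx] := hY v; first by rewrite inE vS tv.
  by apply/bigcupP; exists x.
have PT u : touch [set u] P -> exists2 a, a \in A & u -- a.
  by case/touchP=> _ [a [/set1P-> /PA aA ua]]; exists a.
have QT u : touch [set u] Q -> exists2 a, a \in B & u -- a.
  by case/touchP=> _ [a [/set1P-> /QB aA ua]]; exists a.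
case=> vW /or3P[]/andP[].
- move=> /PT[a aA va] /QT[b bB vb].
  have vA : v \notin A by apply/negP=> vA; rewrite (fp_edge fp vA bB) in vb.
  exact: (fp_inl fp vA aA va).
- move=> /PT[a aA va] /bigcupP[x xX vx].
  have := subsetP XK _ xX; rewrite inE => /and3P[xS tx _].
  have : side v by rewrite -(sideC x) // sideS.
  case/orP=> [vB|/andP[vM _]]; first by rewrite sedge_sym (fp_edge fp aA vB) in va.
  by apply: (in_separator fp vM _ va); rewrite aA.
move=> /QT[b bB vb] /bigcupP[x xX vx].
have := subsetP YK _ xX; rewrite inE => /and3P[xS tx _].
have : ~~ side v by rewrite -(sideC x) // sideS.
rewrite negb_or => /andP[vB _].
exact: (fp_inr fp vB bB vb).
Qed.

Lemma butterfly_free_count :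
  num_minimal_separators G <= #|G|.+1 ^ (4 * 32).
Proof.
apply: (@card_small_sets _ _ _ separator_of_code) => S.
rewrite inE => /minimal_separator_full[A [B fp]].
exact: butterfly_free_code fp.
Qed.

End ButterflyCount.

(** * Polynomial against exponential growth *)

Section Growth.
Variable R : realType.
Local Open Scope ring_scope.

Lemma bernoulli_ineq (h : R) (n : nat) : 0 <= h -> 1 + n%:R * h <= (1 + h) ^+ n.
Proof.
move=> h0; elim: n => [|n IH]; first by rewrite mul0r addr0 expr0.
rewrite exprS; apply: (@le_trans _ _ ((1 + h) * (1 + n%:R * h))).
  have nh : 0 <= h * (n%:R * h) by rewrite !mulr_ge0.
  by rewrite mulrDl mul1r mulrDr mulr1 -natr1 mulrDl mul1r -!addrA lerD2l lerD2l lerDl.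
by rewrite ler_wpM2l // addr_ge0.
Qed.

Lemma horner_le_expr (p : {poly R}) : exists2 K : R, 0 <= K &
  forall x, 0 <= x -> p.[x] <= K * (x + 1) ^+ size p.
Proof.
exists (\sum_(i < size p) `|p`_i|); first exact: sumr_ge0.
move=> x x0; rewrite horner_coef mulr_suml; apply: ler_sum => i _.
have x1 : 1 <= x + 1 by rewrite lerDr.
apply: le_trans (ler_norm _) _; rewrite normrM ler_wpM2l // ger0_norm ?exprn_ge0 //.
apply: le_trans (_ : (x + 1) ^+ i <= _); last by rewrite ler_weXn2l // ltnW.
by rewrite lerXn2r ?nnegrE ?lerDl // addr_ge0.
Qed.

(** With D = size p + 1 and q = n / D one has c^n >= (c^q)^D >= t^D, where
    t = 1 + q (c - 1) by Bernoulli, while p(n) is at most a constant times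
    (n + 1)^(D - 1), hence at most a constant times t^(D - 1). *)
Lemma exp_dominates_poly (c : R) (p : {poly R}) : 1 < c ->
  exists N, forall n, (N <= n)%N -> p.[n%:R] < c ^+ n.
Proof.
move=> c1; have [K K0 hK] := horner_le_expr p.
set d := size p in hK; pose D := d.+1; pose h := c - 1.
have h0 : 0 < h by rewrite subr_gt0.
have hV0 : 0 <= h^-1 by rewrite invr_ge0 ltW.
have hD0 : 0 <= 1 + h^-1 by rewrite addr_ge0.
pose K' := K * (D%:R * (1 + h^-1)) ^+ d.
exists (Num.bound (K' / h) * D)%N => n leNn.
pose q := (n %/ D)%N; pose t := 1 + q%:R * h.
have leNq : (Num.bound (K' / h) <= q)%N by rewrite leq_divRL.
have t0 : 0 < t by rewrite ltr_pwDl // mulr_ge0 // ltW.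
have t1 : 1 <= t by rewrite lerDl mulr_ge0 // ltW.
have K't : K' < t.
  have K'0 : 0 <= K' / h.
    by apply: divr_ge0; [rewrite mulr_ge0 // exprn_ge0 // mulr_ge0|exact: ltW].
  have := archi_boundP K'0; rewrite ltr_pdivrMr // => lt1.
  apply: lt_le_trans lt1 _; apply: (@le_trans _ _ (q%:R * h)); last by rewrite lerDr.
  by rewrite ler_pM2r // ler_nat.
have leD : n%:R + 1 <= D%:R * (1 + h^-1) * t.
  apply: (@le_trans _ _ (D%:R * (q%:R + 1))).
    rewrite !natr1 -natrM ler_nat mulnC; exact: ltn_ceil.
  have -> : D%:R * (1 + h^-1) * t = D%:R * (q%:R + 1 + (h^-1 + q%:R * h)).
    by rewrite /t; field; rewrite gt_eqF.
  by rewrite ler_wpM2l // lerDl addr_ge0 // mulr_ge0 // ltW.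
apply: (@le_lt_trans _ _ (K' * t ^+ d)).
  apply: le_trans (hK _ _) _ => //; rewrite /K' -mulrA ler_wpM2l // -exprMn.
  by rewrite lerXn2r ?nnegrE ?addr_ge0 // !mulr_ge0 // ltW.
apply: (@lt_le_trans _ _ (t ^+ D)).
  by rewrite exprS ltr_pM2r // exprn_gt0.
apply: (@le_trans _ _ ((c ^+ q) ^+ D)).
  rewrite lerXn2r ?nnegrE ?(ltW t0) ?exprn_ge0 //; first by apply: ltW; apply: lt_trans c1.
  have := bernoulli_ineq q (ltW h0); by rewrite /h subrKC.
by rewrite -exprM ler_weXn2l ?(ltW c1) // leq_trunc_div.
Qed.

End Growth.

(** A graph of order at most N is determined up to isomorphism by its order and
    the set of edges between the ranks of its vertices, which leaves finitely
    many possibilities. *)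
Lemma nonisomorphic_unbounded (F : nat -> sgraph) (N : nat) :
  (forall i j, i <> j -> ~ isomorphic (F i) (F j)) -> exists i, N < #|F i|.
Proof.
move=> niso; pose codeT : finType := ('I_N.+1 * {set 'I_N.+1 * 'I_N.+1})%type.
pose r i (x : F i) : 'I_N.+1 := inord (enum_rank x).
pose edges i : {set 'I_N.+1 * 'I_N.+1} :=
  [set ab | [exists x, exists y, [&& sedge x y, r i x == ab.1 & r i y == ab.2]]].
pose code (i : 'I_#|codeT|.+1) : codeT := (inord #|F i|, edges i).
have [i ltN|small] := pickP [pred i : 'I_#|codeT|.+1 | ~~ (#|F i| <= N)].
  by exists i; rewrite ltnNge.
have {}small (i : 'I_#|codeT|.+1) : #|F i| <= N.
  exact: negbFE (small i).
have /injectivePn[i [j ij eij]] : ~~ injectiveb code.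
  by apply/negP=> /injectiveP/leq_card; rewrite card_ord ltnn.
have ij' : (i : nat) <> j by move=> e; move/eqP: ij; apply; apply: val_inj.
case: (niso _ _ ij'); move: eij; rewrite /code => -[/(congr1 val) /=].
rewrite !inordK ?ltnS ?small // => eqcard eqedges.
have rK (k : 'I_#|codeT|.+1) (x : F k) : r k x = enum_rank x :> nat.
  by rewrite /r inordK //; apply: leq_trans (ltn_ord _) _; apply: leq_trans (small k) _.
have edgeE (k : 'I_#|codeT|.+1) (x y : F k) : sedge x y = ((r k x, r k y) \in edges k).
  rewrite inE; apply/idP/existsP=> [xy|[x' /existsP[y' /and3P[xy /eqP ex /eqP ey]]]].
    by exists x; apply/existsP; exists y; rewrite xy !eqxx.
  have rinj : injective (r k).
    by move=> a b /(congr1 val) /=; rewrite !rK => /ord_inj /enum_rank_inj.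
  by rewrite -(rinj _ _ ex) -(rinj _ _ ey).
pose f (x : F i) : F j := enum_val (cast_ord eqcard (enum_rank x)).
have rf x : r j (f x) = r i x by apply: val_inj; rewrite /= !rK enum_valK.
exists f; last by move=> x y; rewrite !edgeE !rf eqedges.
exists (fun y => enum_val (cast_ord (esym eqcard) (enum_rank y))) => x.
  by rewrite /f enum_valK cast_ordK enum_rankK.
by rewrite /f enum_valK cast_ordKV enum_rankK.
Qed.

Section TameFeralFacts.
Variable R : realType.
Local Open Scope ring_scope.

Lemma tame_not_feral (C : graph_class) : tame R C -> ~ feral R C.
Proof.
move=> [p hp] [c c1 [F niso hF]].
have [N hN] := exp_dominates_poly p c1.
have [i Ni] := nonisomorphic_unbounded N niso.
have [CF cF] := hF i.
have := lt_le_trans (hN _ (ltnW Ni)) (le_trans cF (hp _ CF)).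
by rewrite ltxx.
Qed.

Lemma tame_of_bound (C : graph_class) (k : nat) :
  (forall G : sgraph, C G -> num_minimal_separators G <= #|G|.+1 ^ k)%N -> tame R C.
Proof.
move=> hC; exists (('X + 1) ^+ k) => G /hC le.
rewrite horner_exp hornerD hornerX hornerC natr1 -natrX ler_nat //.
Qed.

End TameFeralFacts.

(** * Ladders *)

Section Ladder.
Variables (c : bool) (k : nat).

(** The first component is the side; None is the hub of that side and Some i
    the inner vertex of the i-th path. *)
Definition ladder_vertex : finType := (bool * option 'I_k)%type.

Definition ladder_edge : rel ladder_vertex := fun u v =>
  if u.1 == v.1 then (u.2 != v.2) && [|| c, u.2 == None | v.2 == None]
  else (u.2 == v.2) && (u.2 != None).

Lemma ladder_edge_sym : symmetric ladder_edge.
Proof.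
move=> u v; rewrite /ladder_edge (eq_sym u.1) (eq_sym u.2); case: ifP => _.
  by rewrite [(u.2 == _) || _]orbC.
by case: eqP => //= ->.
Qed.

Lemma ladder_edge_irrefl : irreflexive ladder_edge.
Proof. by move=> u; rewrite /ladder_edge !eqxx. Qed.

Definition ladder : sgraph := SGraph ladder_edge_sym ladder_edge_irrefl.

(** On the path i in I the vertex on the side false, on the others the one on
    the side true. *)
Definition transversal (I : {set 'I_k}) : {set ladder} :=
  [set v : ladder_vertex | if v.2 is Some i then v.1 != (i \in I) else false].

Lemma transversal_inj : injective transversal.
Proof.
move=> I J eIJ; apply/setP=> i.
have : ((true, Some i) : ladder_vertex) \in transversal I =
       (((true, Some i) : ladder_vertex) \in transversal J) by rewrite eIJ.
by rewrite !inE /=; case: (i \in I); case: (i \in J).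
Qed.

(** A path between the hubs has to change sides along some rung, which components_of the
    transversal.  If one vertex of the transversal is put back, the rung
    containing it becomes free. *)
Lemma transversal_separator (I : {set 'I_k}) : minimal_separator (transversal I).
Proof.
apply/existsP; exists ((false, None) : ladder_vertex).
apply/existsP; exists ((true, None) : ladder_vertex).
apply/and5P; split; rewrite ?inE //.
- rewrite connected_avoidingE; apply/negP=> h.
  pose P (v : ladder) := ~~ v.1.
  suff cl u v : u \in ~: transversal I -> v \in ~: transversal I ->
    P u -> u -- v -> P v by have := component_ind h isT cl.
  case: u v => [s x] [t y]; rewrite !in_setC !inE /P /= /ladder_edge /=.
  case: s; case: t => //= hx hy _ /andP[/eqP xy xN]; move: xN hx hy; rewrite -xy.
  by case: x {xy} => // i _; case: (i \in I).
apply/forallP=> S'; apply/implyP=> /properP[/subsetP sub [[s x] xI xS']].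
move: xI; rewrite inE /=; case: x xS' => // i xS' si.
have out t : ((t, Some i) : ladder_vertex) \notin S'.
  have [-> //|ts] := eqVneq t s.
  apply/negP=> /sub; rewrite inE /=.
  by case: t s ts si {xS'} => [] [] //; case: (i \in I).
have outN t : ((t, None) : ladder_vertex) \notin S' by apply/negP=> /sub; rewrite inE.
apply: (@connect_trans _ _ ((false, Some i) : ladder_vertex)).
  by apply: connect1; rewrite /= out outN /ladder_edge /= orbT.
apply: (@connect_trans _ _ ((true, Some i) : ladder_vertex)).
  by apply: connect1; rewrite /= !out /ladder_edge /= eqxx.
by apply: connect1; rewrite /= out outN /ladder_edge /= orbT.
Qed.

Lemma ladder_separators : 2 ^ k <= num_minimal_separators ladder.
Proof.
apply: (@leq_trans #|[set transversal I | I in powerset [set: 'I_k]]|).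
  by rewrite card_imset ?card_powerset ?cardsT ?card_ord //; apply: transversal_inj.
apply/subset_leq_card/subsetP=> _ /imsetP[I _ ->].
by rewrite inE transversal_separator.
Qed.

Lemma card_ladder : #|ladder| = (2 * k.+1)%N.
Proof. by rewrite card_prod card_bool card_option card_ord. Qed.

End Ladder.

(** The base 9/8 is chosen such that its fourth power is at most 2; the ladder
    with k.+1 paths has 2k+4 vertices. *)
Lemma ladders_feral (R : realType) (C : graph_class) (c : bool) :
  (forall k, C (ladder c k)) -> feral R C.
Proof.
move=> hC; exists (9%:R / 8%:R)%R.
  by rewrite ltr_pdivlMr ?ltr0n // mul1r ltr_nat.
exists (fun i => ladder c i.+1).
  move=> i j ij [f /bij_eq_card]; rewrite !card_ladder => /eqP.
  by rewrite eqn_pmul2l // => /eqP[].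
move=> i; split; first exact: hC.
apply: (@le_trans _ _ ((2 ^ i.+1)%:R)%R); last by rewrite ler_nat ladder_separators.
rewrite card_ladder exprM natrX.
set q := ((9%:R / 8%:R) ^+ 2)%R.
have q0 : (0 <= q)%R by rewrite exprn_ge0 // divr_ge0 // ler0n.
have q2 : (q ^+ 2 <= 2)%R.
  by rewrite /q -exprM expr_div_n ler_pdivrMr ?exprn_gt0 ?ltr0n // -!natrX -natrM ler_nat.
have q2' : (q <= 2)%R.
  by rewrite /q expr_div_n ler_pdivrMr ?exprn_gt0 ?ltr0n // -!natrX -natrM ler_nat.
elim: i => [|i IH]; first by rewrite expr1.
by rewrite [(q ^+ _)%R]exprS [(2 ^+ _)%R]exprS ler_pM // exprn_ge0.
Qed.

Section LadderModels.
Variable H : sgraph.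

(** Each side of the ladder is a clique, so the branch sets that meet one side,
    and likewise those that miss it, are pairwise adjacent. *)
Lemma clique_ladder_cobipartite k (phi : H -> {set ladder true k}) : model phi ->
  exists g : H -> bool, forall x y, x != y -> g x = g y -> x -- y.
Proof.
move=> [cphi dphi ephi]; pose g x := [exists v in phi x, v.1].
exists g => x y xy gxy; rewrite ephi //.
have [s [u [v [ux vy us vs]]]] : exists s u v, [/\ u \in phi x, v \in phi y, u.1 = s & v.1 = s].
  case gx: (g x).
    have /existsP[u /andP[ux u1]] : [exists v in phi x, v.1] := gx.
    rewrite gxy in gx.
    have /existsP[v /andP[vy v1]] : [exists v in phi y, v.1] := gx.
    by exists true, u, v; rewrite u1 v1.
  have [u ux] := conn_neq0 (cphi x); have [v vy] := conn_neq0 (cphi y).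
  exists false, u, v; split=> //; apply/negbTE/negP=> h.
    have /existsPn/(_ u) : ~~ [exists v in phi x, v.1] := negbT gx.
    by rewrite ux h.
  rewrite gxy in gx; have /existsPn/(_ v) : ~~ [exists v in phi y, v.1] := negbT gx.
  by rewrite vy h.
apply/touchP; exists u, v; split=> //; change (ladder_edge true u v).
rewrite /ladder_edge us vs eqxx /= andbT; apply/eqP=> uv2.
have uv : u = v by case: u v us vs uv2 {ux vy} => [? ?] [? ?] /= -> -> ->.
by apply: (disjoint_contra (dphi _ _ xy) ux); rewrite uv.
Qed.

Definition inner (h : bool -> option H) x := (h false != Some x) && (h true != Some x).

(** What remains of a ladder with independent sides in a minor of it: h s is the
    vertex whose branch set contains the hub of side s, if there is one.  The
    branch set of an inner vertex lies within one rung. *)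
Record hub_structure (h : bool -> option H) : Prop := HubStructure {
  hub_matching : forall x y z, inner h x -> inner h y -> inner h z ->
    x -- y -> y -- z -> x = z;
  hub_cover : forall a b x, h false = Some a -> h true = Some b -> inner h x ->
    x -- a || x -- b;
  hub_split : forall s a x y, h s = Some a -> h (~~ s) != Some a ->
    inner h x -> inner h y -> x -- y -> x -- a != y -- a }.

(** Two adjacent inner vertices share a rung, and their branch sets are its two
    vertices, one on each side; this leaves no room for a third, and only the
    one on side s is adjacent to the hub of side s. *)
Lemma ladder_hub_structure k (phi : H -> {set ladder false k}) : model phi ->
  exists h, hub_structure h.
Proof.
move=> [cphi dphi ephi].
pose hub s : ladder false k := ((s, None) : ladder_vertex k).
pose h s := [pick x | hub s \in phi x].
have hE s a : (h s == Some a) = (hub s \in phi a).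
  rewrite /h; case: pickP => [x sx|none]; last by rewrite none.
  apply/eqP/idP=> [[<-] //|sa]; congr Some.
  by apply/eqP/negPn/negP=> xa; apply: (disjoint_contra (dphi _ _ xa) sx sa).
have innerE x : inner h x = (hub false \notin phi x) && (hub true \notin phi x).
  by rewrite /inner !hE.
have some_idx x v : inner h x -> v \in phi x -> v.2 != None.
  rewrite innerE => /andP[nf nt] vx; apply/eqP=> v2.
  by case: v v2 vx => [[] w] /= ->; apply/negP.
have rung x : inner h x -> exists i, forall v, v \in phi x -> v.2 = Some i.
  move=> ix; have [v vx] := conn_neq0 (cphi x).
  case v2: v.2 => [i|]; last by have := some_idx _ _ ix vx; rewrite v2.
  exists i => w wx; apply/eqP; move: w wx.
  apply: ((cphi x).2 (fun w : ladder false k => w.2 == Some i)); first by exists v; rewrite // v2.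
  move=> u w ux wx /eqP u2 uw; have : ladder_edge false u w := uw.
  have w2 := some_idx _ _ ix wx; rewrite /ladder_edge; case: ifP => _.
    by rewrite u2 (negPf w2) andbF.
  by rewrite u2 => /andP[/eqP<-].
have adj_rung x y i j : inner h x -> inner h y -> x -- y ->
    (forall v, v \in phi x -> v.2 = Some i) -> (forall v, v \in phi y -> v.2 = Some j) -> i = j.
  move=> ix iy xy hi hj.
  have neq : x != y by apply: contraTneq xy => ->; rewrite sedge_irrefl.
  move: xy; rewrite ephi // => /touchP[u [w [ux wy uw]]].
  have : ladder_edge false u w := uw.
  rewrite /ladder_edge (hi _ ux) (hj _ wy); case: ifP => _; first by rewrite andbF.
  by case/andP=> /eqP[].
have disj x y v : x != y -> v \in phi x -> v \in phi y -> False.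
  by move=> xy; apply: disjoint_contra; apply: dphi.
have pairE (u v : ladder false k) : u.1 = v.1 -> u.2 = v.2 -> u = v.
  by case: u v => [? ?] [? ?] /= -> ->.
exists h; split.
- move=> x y z ix iy iz xy yz; apply/eqP/negPn/negP=> xz.
  have xy' : x != y by apply: contraTneq xy => ->; rewrite sedge_irrefl.
  have yz' : y != z by apply: contraTneq yz => ->; rewrite sedge_irrefl.
  have [i hx] := rung _ ix; have [j hy] := rung _ iy; have [l hz] := rung _ iz.
  have ij := adj_rung _ _ _ _ ix iy xy hx hy; have jl := adj_rung _ _ _ _ iy iz yz hy hz.
  subst j l.
  have [u ux] := conn_neq0 (cphi x); have [v vy] := conn_neq0 (cphi y).
  have [w wz] := conn_neq0 (cphi z).
  have uv : u.1 != v.1.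
    apply/eqP=> e; apply: (disj _ _ u xy' ux).
    by rewrite (pairE u v) // (hx _ ux) (hy _ vy).
  have vw : v.1 != w.1.
    apply/eqP=> e; apply: (disj _ _ v yz' vy).
    by rewrite (pairE v w) // (hy _ vy) (hz _ wz).
  have uw : u.1 != w.1.
    apply/eqP=> e; apply: (disj _ _ u xz ux).
    by rewrite (pairE u w) // (hx _ ux) (hz _ wz).
  by move: uv vw uw; case: u.1; case: v.1; case: w.1.
- move=> a b x /eqP; rewrite hE => ha /eqP; rewrite hE => hb ix.
  have [u ux] := conn_neq0 (cphi x); have u2 := some_idx _ _ ix ux.
  have step s y : hub s \in phi y -> u.1 = s -> x -- y.
    move=> sy us; rewrite ephi; last first.
      by apply: contraTneq ix => ->; rewrite innerE; case: s sy {us} => ->; rewrite ?andbF.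
    apply/touchP; exists u, (hub s); split=> //; change (ladder_edge false u (hub s)).
    by rewrite /ladder_edge us eqxx u2 /= orbT.
  by case us: u.1; [rewrite (step true b) ?orbT|rewrite (step false a)].
move=> s a x y /eqP; rewrite hE => sa; rewrite hE => nsa ix iy xy.
have [i hx] := rung _ ix; have [j hy] := rung _ iy.
have ij := adj_rung _ _ _ _ ix iy xy hx hy; subst j.
have xy' : x != y by apply: contraTneq xy => ->; rewrite sedge_irrefl.
have [u ux] := conn_neq0 (cphi x); have [v vy] := conn_neq0 (cphi y).
have uv : u.1 != v.1.
  apply/eqP=> e; apply: (disj _ _ u xy' ux).
  by rewrite (pairE u v) // (hx _ ux) (hy _ vy).
(* z and z' share a rung, with w on it in the branch set of z. *)
have adjE z z' w w' : inner h z -> inner h z' -> z != z' -> w \in phi z -> w' \in phi z' ->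
    w.2 = Some i -> w'.2 = Some i -> w.1 != w'.1 ->
    (forall t, t \in phi z -> t.2 = Some i) -> z -- a = (w.1 == s).
  move=> iz iz' zz' wz wz' w2 w2' ww' hz.
  have za : z != a.
    by apply: contraTneq iz => ->; rewrite innerE; case: s sa {nsa} => ->; rewrite ?andbF.
  have z'a : z' != a.
    by apply: contraTneq iz' => ->; rewrite innerE; case: s sa {nsa} => ->; rewrite ?andbF.
  rewrite ephi //; apply/touchP/eqP=> [[t [r [tz ra tr]]]|ws].
    have tw : t.1 = w.1.
      case: (eqVneq t.1 w.1) => // tw.
      have : t = w'.
        apply: pairE; last by rewrite hz.
        by move: tw ww'; case: t.1; case: w.1; case: w'.1.
      by move=> e; case: (disj _ _ t zz' tz); rewrite e.
    have : ladder_edge false t r := tr; rewrite /ladder_edge (hz _ tz) tw.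
    case: eqP => [wr /andP[_ /= /eqP r2]|/eqP wr /andP[/eqP r2 _]].
      have er : r = hub r.1 by apply: pairE.
      case: (eqVneq r.1 s) => [<- //|rs]; case/negP: nsa.
      suff -> : ~~ s = r.1 by rewrite -er.
      by move: rs; case: s {sa}; case: r.1.
    have : r = w'.
      by apply: pairE; [move: wr ww'; case: w.1; case: r.1; case: w'.1|rewrite w2'].
    by move=> e; case: (disj _ _ r z'a _ ra); rewrite e.
  exists w, (hub s); split=> //; change (ladder_edge false w (hub s)).
  by rewrite /ladder_edge ws eqxx w2.
have yx : y != x by rewrite eq_sym.
have vu : v.1 != u.1 by rewrite eq_sym.
rewrite (adjE x y u v ix iy xy' ux vy (hx _ ux) (hy _ vy) uv hx).
rewrite (adjE y x v u iy ix yx vy ux (hy _ vy) (hx _ ux) vu hy).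
by move: uv; case: u.1; case: v.1; case: s {sa nsa adjE}.
Qed.

End LadderModels.

(** * Classification of the common minors of all ladders *)

Section SmallGraph.
Variables (H : sgraph) (g : H -> bool) (h : bool -> option H).
Hypothesis hg : forall x y, x != y -> g x = g y -> x -- y.
Hypothesis hh : hub_structure h.

Lemma no_three_independent (x y z : H) : x != y -> x != z -> y != z ->
  [|| x -- y, x -- z | y -- z].
Proof.
move=> xy xz yz; have := (hg xy, hg xz, hg yz).
case: (g x); case: (g y); case: (g z) => -[[]];
  by do ?[move/(_ erefl)-> | move=> _]; rewrite ?orbT.
Qed.

(** Each of the two cliques contains at most two inner vertices.  If there are
    four, they form two disjoint edges, and were there two different hubs, then
    a hub a and an end not adjacent to a of each of these edges would be
    independent. *)
Lemma hub_structure_card : #|H| <= 5.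
Proof.
pose I := [set x | inner h x].
pose J b := [set x in I | g x == b].
have JI b x : x \in J b -> inner h x && (g x == b) by rewrite !inE.
have J2 b : #|J b| <= 2.
  rewrite leqNgt; apply/negP=> /card_gt2P[x [y [z [[]]]]].
  move=> /JI/andP[ix /eqP gx] /JI/andP[iy /eqP gy] /JI/andP[iz /eqP gz] [xy yz zx].
  move/eqP: zx; apply; apply: esym.
  by apply: (hub_matching hh ix iy iz); apply: hg; rewrite ?gx ?gy ?gz.
have cardI : #|I| <= #|J false| + #|J true|.
  apply: leq_trans (leq_card_setU _ _); apply/subset_leq_card/subsetP=> x xI.
  by rewrite !inE in xI *; rewrite xI; case: (g x).
pose O s := [set x | h s == Some x].
have O1 s : #|O s| <= 1.
  by apply/card_le1_eqP=> x y; rewrite !inE => /eqP-> /eqP[].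
have cardH : #|H| <= #|I| + #|O false :|: O true|.
  rewrite -(cardsC I) leq_add2l; apply/subset_leq_card/subsetP=> x.
  by rewrite !inE /inner negb_and !negbK.
have O2 : #|O false :|: O true| <= 2.
  by apply: leq_trans (leq_card_setU _ _) _; apply: (@leq_add _ _ 1 1).
rewrite leqNgt; apply/negP=> H6.
have I4 : 4 <= #|I|.
  by have := leq_trans H6 cardH => le6; have := leq_trans le6 (leq_add (leqnn _) O2); rewrite addn2 !ltnS.
have Jeq b : #|J b| = 2.
  apply/eqP; rewrite eqn_leq J2 leqNgt; apply/negP=> lt.
  have := leq_trans I4 cardI; case: b lt => lt.
    by rewrite leqNgt (leq_ltn_trans (leq_add (J2 false) (leqnn _))) // -[4]/(2 + 2) ltn_add2l.
  by rewrite leqNgt (leq_ltn_trans (leq_add (leqnn _) (J2 true))) // -[4]/(2 + 2) ltn_add2r.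
have Ieq : #|I| <= 4 by apply: leq_trans cardI _; rewrite !Jeq.
have Ogt : 1 < #|O false :|: O true|.
  by rewrite -(ltn_add2l 4); apply: leq_trans H6 (leq_trans cardH _); rewrite leq_add2r.
have [a [b [aO bO ab]]] := card_gt1P Ogt.
have [s [hs hns]] : exists s, h s = Some a /\ h (~~ s) != Some a.
  have nSome : Some b != Some a by apply: contraNneq ab => -[->].
  by move: aO bO; rewrite !inE => /orP[]/eqP ha /orP[]/eqP hb;
    [case/eqP: ab; apply: Some_inj; rewrite -ha -hb
    |exists false; rewrite ha hb|exists true; rewrite ha hb
    |case/eqP: ab; apply: Some_inj; rewrite -ha -hb].
have pick_nonadj t : exists2 x, x \in J t & ~~ x -- a.
  have /card_gt1P[x [y [xJ yJ xy]]] : 1 < #|J t| by rewrite Jeq.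
  have /andP[ix /eqP gx] := JI _ _ xJ; have /andP[iy /eqP gy] := JI _ _ yJ.
  have exy : x -- y by apply: hg; rewrite // gx gy.
  have := hub_split hh hs hns ix iy exy.
  have [xa ya|xa _] := boolP (x -- a); last by exists x.
  by exists y => //; move: ya; case: (y -- a).
have [x xJ xa] := pick_nonadj false; have [y yJ ya] := pick_nonadj true.
have /andP[ix /eqP gx] := JI _ _ xJ; have /andP[iy /eqP gy] := JI _ _ yJ.
have nxy : ~~ x -- y.
  apply/negP=> exy.
  have /card_gt0P[z] : 0 < #|J true :\ y|.
    by move: (Jeq true); rewrite (cardsD1 y) yJ add1n => -[->].
  rewrite in_setD1 => /andP[zy /JI/andP[iz /eqP gz]].
  have eyz : y -- z by apply: hg; rewrite ?gy ?gz // eq_sym.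
  by have := hub_matching hh ix iy iz exy eyz => xz; rewrite xz gz in gx.
have notin_inner z : inner h z -> z != a.
  move=> iz; apply: contraTneq iz => ->; rewrite /inner.
  by case: s hs {hns} => ->; rewrite eqxx ?andbF.
have xy : x != y by apply/eqP=> e; rewrite e gy in gx.
have := no_three_independent xy (notin_inner _ ix) (notin_inner _ iy).
by rewrite (negPf nxy) (negPf xa) (negPf ya).
Qed.

End SmallGraph.


(** The classification is checked by evaluation, which computes both arguments
    of the Boolean connectives; these conditionals stop early. *)
Local Notation "b &&& c" := (if b then c else false)
  (at level 41, right associativity).
Local Notation "b =>> c" := (if b then c else true)
  (at level 39, no associativity).

Fixpoint lazy_all (T : Type) (p : pred T) (s : seq T) : bool :=
  if s is x :: s' then p x &&& lazy_all p s' else true.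

Fixpoint lazy_has (T : Type) (p : pred T) (s : seq T) : bool :=
  if s is x :: s' then if p x then true else lazy_has p s' else false.

Lemma lazy_andT (b c : bool) : b -> c -> b &&& c.
Proof. by case: b. Qed.

Lemma lazy_allE (T : Type) (p : pred T) s : lazy_all p s = all p s.
Proof. by elim: s => //= x s ->; case: (p x). Qed.

Lemma lazy_hasE (T : Type) (p : pred T) s : lazy_has p s = has p s.
Proof. by elim: s => //= x s ->; case: (p x). Qed.

Definition all_pairs (n : nat) (r : rel nat) : bool :=
  lazy_all (fun j => lazy_all (fun i => r i j) (iota 0 j)) (iota 0 n).

Lemma all_pairsP n (r : rel nat) :
  reflect (forall i j, i < j -> j < n -> r i j) (all_pairs n r).
Proof.
rewrite /all_pairs lazy_allE; apply: (iffP allP) => [hall i j ij jn|hr j].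
  have := hall j; rewrite mem_iota /= add0n lazy_allE => /(_ jn)/allP; apply.
  by rewrite mem_iota.
by rewrite mem_iota lazy_allE => jn; apply/allP=> i; rewrite mem_iota => ij; apply: hr.
Qed.

Fixpoint bitseqs (n : nat) : seq bitseq :=
  if n is n'.+1 then [seq rcons s b | s <- bitseqs n', b <- [:: true; false]]
  else [:: [::]].

Lemma mkseq_bitseqs (f : nat -> bool) n : mkseq f n \in bitseqs n.
Proof.
elim: n => [|n IH]; [exact: mem_head|rewrite mkseqS].
by apply/allpairsPdep; exists (mkseq f n), (f n); split=> //; case: (f n).
Qed.

(** Graphs on n ordered vertices as lower triangles of adjacency matrices: row j
    lists the adjacency of j to the vertices i < j. *)
Fixpoint triangles (n : nat) : seq (seq bitseq) :=
  if n is n'.+1 then [seq rcons m r | m <- triangles n', r <- bitseqs n']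
  else [:: [::]].

Definition triangle (r : rel nat) (n : nat) : seq bitseq :=
  mkseq (fun j => mkseq (r^~ j) j) n.

Lemma triangle_triangles r n : triangle r n \in triangles n.
Proof.
elim: n => [|n IH]; [exact: mem_head|rewrite /triangle mkseqS].
apply/allpairsPdep; exists (triangle r n), (mkseq (r^~ n) n).
by split=> //; apply: mkseq_bitseqs.
Qed.

Definition triangle_edge (m : seq bitseq) : rel nat := fun i j =>
  nth false (nth [::] m (maxn i j)) (minn i j).

Lemma triangle_edgeE (r : rel nat) n i j :
  (forall i, r i i = false) -> (forall i j, r i j = r j i) -> i < n -> j < n ->
  triangle_edge (triangle r n) i j = r i j.
Proof.
move=> rirr rsym ltin ltjn; rewrite /triangle_edge /triangle nth_mkseq; last first.
  by rewrite gtn_max ltin.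
have [ltij|ltji|<-] := ltngtP i j.
- by rewrite nth_mkseq.
- by rewrite nth_mkseq.
by rewrite nth_default ?size_mkseq // rirr.
Qed.

Definition cobipartite_test (n : nat) (e : rel nat) : bool :=
  lazy_has (fun b => all_pairs n (fun i j =>
      (nth false b i == nth false b j) =>> e i j))
    (bitseqs n).

(** The hubs are vertices a and b; the value n encodes the absence of a hub. *)
Definition hub_structure_test (n : nat) (e : rel nat) (a b : nat) : bool :=
  let I := [seq x <- iota 0 n | (a != x) && (b != x)] in
  let edges (r : rel nat) := lazy_all (fun x => lazy_all (fun y =>
     e x y =>> r x y) I) I in
  edges (fun x y => lazy_all (fun z => e y z =>> (x == z)) I) &&&
  (((a < n) && (b < n)) =>> lazy_all (fun x => e x a || e x b) I) &&&
  (((a < n) && (b != a)) =>> edges (fun x y => e x a != e y a)) &&&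
  (((b < n) && (b != a)) =>> edges (fun x y => e x b != e y b)).

(** Order and edges of the diamond, the butterfly and the house. *)
Definition targets : seq (nat * seq (nat * nat)) :=
  [:: (4, [:: (0, 1); (0, 2); (0, 3); (1, 2); (1, 3)]);
      (5, [:: (0, 1); (2, 3); (4, 0); (4, 1); (4, 2); (4, 3)]);
      (5, [:: (0, 1); (1, 2); (2, 3); (3, 4); (0, 4); (0, 3)])].

Definition embedding_test (n : nat) (e : rel nat) (T : nat * seq (nat * nat)) : bool :=
  (n <= T.1) &&& lazy_has (fun t => all_pairs n (fun i j =>
        (((nth 0 t i, nth 0 t j) \in T.2) || ((nth 0 t j, nth 0 t i) \in T.2))
          == e i j))
    (permutations (iota 0 T.1)).

Definition classification_test (n : nat) (e : rel nat) : bool :=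
  (cobipartite_test n e &&&
   lazy_has (fun a => lazy_has (hub_structure_test n e a) (iota 0 n.+1))
     (iota 0 n.+1)) =>> lazy_has (embedding_test n e) targets.

Lemma classification_all :
  lazy_all (fun n => lazy_all (fun m => classification_test n (triangle_edge m))
    (triangles n)) (iota 0 6).
Proof. by vm_compute. Qed.

Section Classification.
Variables (H : sgraph) (x0 : H).

Let s := enum H.
Let n := #|H|.
Let r : rel nat := fun i j => nth x0 s i -- nth x0 s j.
Let e : rel nat := triangle_edge (triangle r n).

Let size_s : size s = n. Proof. by rewrite /s -cardE. Qed.

Let ltn_index x : index x s < n.
Proof. by rewrite -size_s index_mem mem_enum. Qed.

Let nth_indexs x : nth x0 s (index x s) = x.
Proof. by rewrite nth_index // mem_enum. Qed.

Let index_nths i : i < n -> index (nth x0 s i) s = i.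
Proof. by move=> lti; rewrite index_uniq ?enum_uniq ?size_s. Qed.

Let eE i j : i < n -> j < n -> e i j = nth x0 s i -- nth x0 s j.
Proof.
by apply: triangle_edgeE => [k|k l]; [exact: sedge_irrefl|exact: sedge_sym].
Qed.

Lemma cobipartite_testT (g : H -> bool) :
  (forall x y, x != y -> g x = g y -> x -- y) -> cobipartite_test n e.
Proof.
move=> hg; rewrite /cobipartite_test lazy_hasE; apply/hasP.
exists (mkseq (fun i => g (nth x0 s i)) n); first exact: mkseq_bitseqs.
apply/all_pairsP=> i j ij jn; have lti := ltn_trans ij jn.
rewrite !nth_mkseq //; case: eqP => // gij; rewrite eE //; apply: hg gij.
by rewrite nth_uniq ?enum_uniq ?size_s // neq_ltn ij.
Qed.

Lemma hub_structure_testT (h : bool -> option H) : hub_structure h ->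
  lazy_has (fun a => lazy_has (hub_structure_test n e a) (iota 0 n.+1)) (iota 0 n.+1).
Proof.
move=> [hM hC hS]; pose pos b := if h b is Some x then index x s else n.
have pos_mem b : pos b \in iota 0 n.+1.
  by rewrite mem_iota add0n ltnS /pos /=; case: (h b) => // x; apply: ltnW.
have posP b : pos b < n -> h b = Some (nth x0 s (pos b)).
  by rewrite /pos; case: (h b) => [x|]; rewrite ?ltnn // nth_indexs.
rewrite lazy_hasE; apply/hasP; exists (pos false) => //.
rewrite lazy_hasE; apply/hasP; exists (pos true) => //.
rewrite /hub_structure_test; set I := filter _ _.
have inI i : i \in I -> i < n /\ inner h (nth x0 s i).
  rewrite mem_filter mem_iota add0n => /andP[/andP[ni1 ni2] lti]; split=> //.
  have neq b : pos b != i -> h b != Some (nth x0 s i).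
    by apply: contraNneq; rewrite /pos => ->; rewrite index_nths.
  by rewrite /inner !neq.
have edgesP (q : rel nat) :
    (forall i j, i \in I -> j \in I -> nth x0 s i -- nth x0 s j -> q i j) ->
    lazy_all (fun x => lazy_all (fun y => if e x y then q x y else true) I) I.
  move=> hq; rewrite lazy_allE; apply/allP=> i iI; rewrite lazy_allE; apply/allP=> j jI.
  have [[lti _] [ltj _]] := (inI i iI, inI j jI).
  by rewrite eE //; case: ifP => // ij; apply: hq.
rewrite edgesP; last first.
  move=> i j iI jI ij; rewrite lazy_allE; apply/allP=> k kI.
  have [[lti ii] [ltj ij']] := (inI i iI, inI j jI); have [ltk ik] := inI k kI.
  rewrite eE //; case: ifP => // jk.
  by rewrite -(index_nths lti) -(index_nths ltk) (hM _ _ _ ii ij' ik ij jk).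
have split b i j : pos b < n -> pos (~~ b) != pos b -> i \in I -> j \in I ->
    nth x0 s i -- nth x0 s j -> e i (pos b) != e j (pos b).
  move=> ltb nb iI jI ij; have [[lti ii] [ltj ij']] := (inI i iI, inI j jI).
  rewrite !eE //; apply: hS ii ij' ij; first exact: posP.
  apply: contraNneq nb => hb; apply/eqP; rewrite {1}/pos hb.
  exact: index_nths.
have cover : (if (pos false < n) && (pos true < n)
    then lazy_all (fun x => e x (pos false) || e x (pos true)) I else true).
  case: ifP => // /andP[ltf ltt]; rewrite lazy_allE; apply/allP=> i iI.
  have [lti ii] := inI i iI; rewrite !eE //.
  exact: (hC _ _ _ (posP _ ltf) (posP _ ltt) ii).
apply: lazy_andT; first exact: cover.
by apply: lazy_andT; case: ifP => // /andP[lts ns]; apply: edgesP => i j;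
  [apply: (split false)|apply: (split true); rewrite 1?eq_sym].
Qed.

Lemma embedding_test_induced_subgraph (k : nat) (E : seq (nat * nat)) :
  embedding_test n e (k, E) -> induced_subgraph H (graph_of_edges k E).
Proof.
rewrite /embedding_test /=; case: ifP => // nk; rewrite lazy_hasE.
move=> /hasP[t]; rewrite mem_permutations => tk /all_pairsP ht.
have size_t : size t = k by rewrite (perm_size tk) size_iota.
have uniq_t : uniq t by rewrite (perm_uniq tk) iota_uniq.
have ltt x : nth 0 t (index x s) < k.
  have : nth 0 t (index x s) \in t.
    by rewrite mem_nth // size_t; apply: leq_trans (ltn_index x) nk.
  by rewrite (perm_mem tk) mem_iota.
pose f (x : H) : graph_of_edges k E := Ordinal (ltt x).
have finj : injective f.
  move=> x y /(congr1 val) /= /eqP; rewrite nth_uniq //; last 2 first.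
  - by rewrite size_t; apply: leq_trans (ltn_index _) nk.
  - by rewrite size_t; apply: leq_trans (ltn_index _) nk.
  by move/eqP=> exy; rewrite -(nth_indexs x) exy nth_indexs.
apply: (embedding_induced_subgraph finj) => x y.
have [<-|xy] := eqVneq x y; first by rewrite !sedge_irrefl.
rewrite [LHS]/= /list_edge (inj_eq finj) xy /=.
have half u v : index u s < index v s ->
    ((nth 0 t (index u s), nth 0 t (index v s)) \in E)
    || ((nth 0 t (index v s), nth 0 t (index u s)) \in E) = u -- v.
  move=> uv; have /eqP-> := ht _ _ uv (ltn_index v).
  by rewrite eE // !nth_indexs.
have : index x s != index y s.
  by apply: contraNneq xy => exy; rewrite -(nth_indexs x) exy nth_indexs.
by rewrite neq_ltn => /orP[/half //|/half hyx]; rewrite orbC hyx sedge_sym.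
Qed.

End Classification.

(** The properties inherited from the two ladders are those that the exhaustive
    check takes as hypotheses. *)
Lemma ladder_minors_classification (H : sgraph) (k l : nat) :
  induced_minor H (ladder false k) -> induced_minor H (ladder true l) ->
  induced_subgraph H diamond \/ induced_subgraph H butterfly \/
    induced_subgraph H house.
Proof.
move=> /induced_minor_model[phi /ladder_hub_structure[h hh]].
move=> /induced_minor_model[psi /clique_ladder_cobipartite[g hg]].
have [x0 _|H0] := pickP (mem H); last first.
  left; have f0 (x : H) : diamond by have := H0 x.
  by apply: (@embedding_induced_subgraph _ _ f0) => x; have := H0 x.
have H5 := hub_structure_card hg hh.
have := classification_all; rewrite lazy_allE => /allP/(_ #|H|).
rewrite mem_iota lazy_allE => /(_ H5)/allP.
pose r : rel nat := fun i j => nth x0 (enum H) i -- nth x0 (enum H) j.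
move=> /(_ _ (triangle_triangles r _)).
rewrite /classification_test (cobipartite_testT x0 hg) (hub_structure_testT x0 hh).
rewrite lazy_hasE => /hasP[T]; rewrite !inE => /or3P[]/eqP-> /embedding_test_induced_subgraph.
- by left.
- by right; left.
by right; right.
Qed.

(** * The dichotomy *)

(** Contract the edge of the house opposite to the roof. *)
Lemma diamond_minor_house : induced_minor diamond house.
Proof.
pose v i (lti : i < 5) : house := Ordinal lti.
pose L : seq {set house} := [:: [set v 0 isT]; [set v 3 isT];
  [set v 1 isT] :|: [set v 2 isT]; [set v 4 isT]].
apply: (@list_model 4 _ house (nth set0 L)) => [i|i j|i j].
- case: i => [|[|[|[|i]]]] //= _; try exact: conn1.
  by apply: connU; [exact: conn1|exact: conn1|rewrite touch11].
- by case: i => [|[|[|[|i]]]]; case: j => [|[|[|[|j]]]] //= _ _;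
    rewrite ?disjoints1 ?(disjoint_sym (_ :|: _)) ?disjoints1 ?inE.
by case: i => [|[|[|[|i]]]]; case: j => [|[|[|[|j]]]] //= _ _;
  rewrite ?touchUl ?touchUr !touch11.
Qed.

Theorem theorem1p7 (R : realType) (H : sgraph) :
  [<-> tame R (induced_minor_free H);
       ~ feral R (induced_minor_free H);
       induced_subgraph H diamond \/ induced_subgraph H butterfly \/
         induced_subgraph H house;
       induced_minor H butterfly \/ induced_minor H house].
Proof.
tfae.
- exact: tame_not_feral.
- move=> notF.
  have some_ladder c : exists k, induced_minor H (ladder c k).
    apply: boolp.contrapT => no; apply: notF; apply: (@ladders_feral _ _ c) => k mk.
    by apply: no; exists k.
  have [k mk] := some_ladder false; have [l ml] := some_ladder true.
  exact: ladder_minors_classification mk ml.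
- case=> [/induced_subgraph_minor m|[|] /induced_subgraph_minor m].
  + by right; apply: induced_minor_trans m diamond_minor_house.
  + by left.
  + by right.
case=> m; [apply: (@tame_of_bound _ _ (4 * 32))|apply: (@tame_of_bound _ _ (4 * 2))] => G free.
  by apply: butterfly_free_count => mG; apply: free; apply: induced_minor_trans m mG.
by apply: house_free_count => mG; apply: free; apply: induced_minor_trans m mG.
Qed.
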